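(* Consider a family of discrete-time systems $x(t+1)=f_i(x(t),v(t))$, $y(t)=h_i(x(t))$, $i\in\mathcal{P}=\{1,\dots,N\}$, with index set partitioned as $\mathcal{P}=\mathcal{P}_S\sqcup\mathcal{P}_U$, a set $E(\mathcal{P})$ of admissible switches, and admissible minimum and maximum dwell times $\Delta_m$ and $\Delta_M$, subject to the standing assumptions given in the context. Let $G(\mathcal{P},E(\mathcal{P}))$ be the underlying weighted directed graph of the switched system, as defined in the context. Suppose that $G(\mathcal{P},E(\mathcal{P}))$ is nicely connected (with a monotone increasing function $\Phi:\mathbb{N}\to\mathbb{R}$) and nicely $\Delta$-weighted (with constants $\Delta,\beta,B,A,\alpha$). Then a switching signal $\sigma$ obtained from the switching-signal construction described in the context (applied to a cycle obtained from the cycle detection algorithm described in the context) satisfies: (i) $\sigma\in\mathcal{S}$, i.e. $\sigma$ is admissible; and (ii) $\sigma$ preserves input/output-to-state stability of the switched system $x(t+1)=f_{\sigma(t)}(x(t),v(t))$, $y(t)=h_{\sigma(t)}(x(t))$ with probability at least $$1-\exp\left(-\frac12\left(\frac{\alpha-\beta}{A+B}\right)^2\lfloor\Phi(|\mathcal{P}_S|)\rfloor\right).$$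
   Context: **Systems.** $\mathbb{N}_0=\{0,1,2,\dots\}$; $\|\cdot\|$ is the Euclidean norm; $\lfloor y\rfloor$ is the largest integer $\le y$; $[\Delta_m:\Delta_M]$ is the set of integers from $\Delta_m$ to $\Delta_M$, where $\Delta_m$ and $\Delta_M$ are the admissible minimum and maximum dwell times on each subsystem. The family of systems is $x(t+1)=f_i(x(t),v(t))$, $x(0)=x_0$, $y(t)=h_i(x(t))$, $t\in\mathbb{N}_0$, $i\in\mathcal{P}=\{1,\dots,N\}$, with $x(t)\in\mathbb{R}^d$, $v(t)\in\mathbb{R}^m$, $y(t)\in\mathbb{R}^p$ the states, inputs and outputs, and $\ker f_i(\cdot,0)=\{0\}$ for each $i$. A switching signal $\sigma:\mathbb{N}_0\to\mathcal{P}$ generates the switched system $x(t+1)=f_{\sigma(t)}(x(t),v(t))$, $y(t)=h_{\sigma(t)}(x(t))$. $\mathcal{P}_S$ and $\mathcal{P}_U$ are the sets of indices of the input/output-to-state stable (IOSS) and the unstable subsystems, $\mathcal{P}=\mathcal{P}_S\sqcup\mathcal{P}_U$. $E(\mathcal{P})$ is the set of ordered pairs $(i,j)$, $i,j\in\mathcal{P}$, $i\ne j$, such that a switch from subsystem $i$ to subsystem $j$ is admissible. **Admissible signals.** Let $0=:\tau_0<\tau_1<\cdots$ be the switching instants (times when $\sigma$ changes its values). $\sigma$ is admissible if $(\sigma(\tau_k),\sigma(\tau_{k+1}))\in E(\mathcal{P})$ and $\tau_{k+1}-\tau_k\in[\Delta_m:\Delta_M]$ for all $k=0,1,2,\dots$.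 $\mathcal{S}$ is the set of admissible switching signals. **IOSS.** The switched system is IOSS for $\sigma\in\mathcal{S}$ (i.e. $\sigma$ preserves IOSS) if there exist $\chi_1\in\mathcal{KL}$ and $\chi_2,\chi_3\in\mathcal{K}$ such that for all bounded inputs $v:\mathbb{N}_0\to\mathbb{R}^m$ and all $x(0)\in\mathbb{R}^d$, $\|x(t)\|\le\chi_1(\|x(0)\|,t)+\chi_2(\|v\|_t)+\chi_3(\|y\|_t)$ for all $t\in\mathbb{N}_0$, where $\|w\|_t:=\sup\{\|w(s)\|:s\in\mathbb{N}_0,s\le t\}$. **Standing Lyapunov assumptions.** For each $i\in\mathcal{P}$ there are continuous functions $V_i:\mathbb{R}^d\to[0,+\infty[$, class $\mathcal{K}_\infty$ functions $\underline\alpha,\overline\alpha$, class $\mathcal{K}$ functions $\gamma_1,\gamma_2$, and scalars $\lambda_i$ with $0<\lambda_i<1$ for $i\in\mathcal{P}_S$ and $\lambda_i>1$ for $i\in\mathcal{P}_U$, such that for all $\xi\in\mathbb{R}^d$, $\eta\in\mathbb{R}^m$: $\underline\alpha(\|\xi\|)\le V_i(\xi)\le\overline\alpha(\|\xi\|)$ and $V_i(f_i(\xi,\eta))\le\lambda_iV_i(\xi)+\gamma_1(\|\eta\|)+\gamma_2(\|h_i(\xi)\|)$. For each $(i,j)\in E(\mathcal{P})$ there is $\mu_{ij}\ge1$ with $V_j(\xi)\le\mu_{ij}V_i(\xi)$ for all $\xi\in\mathbb{R}^d$. **Underlying weighted directed graph $G(\mathcal{P},E(\mathcal{P}))$.**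 Vertex set $\mathcal{P}$, directed edge set $E(\mathcal{P})$; vertex weights $w(j)=-|\ln\lambda_j|$ for $j\in\mathcal{P}_S$ and $w(j)=|\ln\lambda_j|$ for $j\in\mathcal{P}_U$; edge weights $w(i,j)=\ln\mu_{ij}$ for $(i,j)\in E(\mathcal{P})$. The weights are treated as random variables; the sets $\mathcal{P}_S,\mathcal{P}_U,E(\mathcal{P})$ are deterministic. A cycle is a closed walk $v_0,(v_0,v_1),v_1,\dots,v_{n-1},(v_{n-1},v_0),v_0$ with $v_0,\dots,v_{n-1}$ distinct and all edges in $E(\mathcal{P})$; its length is $n$. **Nicely connected.** For $v\in\mathcal{P}$ let $N^+_{\mathcal{P}_S}(v)=\{u\in\mathcal{P}_S:(v,u)\in E(\mathcal{P})\}$ and $d^+_{\mathcal{P}_S}(v)=|N^+_{\mathcal{P}_S}(v)|$. Given a monotone increasing $\Phi:\mathbb{N}\to\mathbb{R}$, the graph is nicely connected if $d^+_{\mathcal{P}_S}(j)\ge\lfloor\Phi(|\mathcal{P}_S|)\rfloor$ for all $j\in\mathcal{P}$. **Nicely $\Delta$-weighted.** The graph is nicely $\Delta$-weighted if: (1) there exist $\Delta\in[\Delta_m:\Delta_M]$ and $0<\beta<B$ such that $0<|w(j)|\Delta\le B$ and $\mathrm{E}\big[|w(j)|\Delta\,\big|\,\{|w(\ell)|\Delta\}_{\ell\ne j},\{w(k,\ell)\}_{(k,\ell)\in E(\mathcal{P})}\big]=\beta$ for all $j\in\mathcal{P}$; and (2) there exist constants $A>0$ and $\alpha<\beta$ such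 that for every $(i,j)\in E(\mathcal{P})$, $w(i,j)\in[-A,A]$ and $\mathrm{E}\big[w(i,j)\,\big|\,\{|w(\ell)|\Delta\}_{\ell\in\mathcal{P}},\{w(k,\ell)\}_{(k,\ell)\ne(i,j)}\big]\le\alpha$. **Cycle detection algorithm.** Pick $v_0\in\mathcal{P}_S$ uniformly at random; set $k=0$. While $N^+_{\mathcal{P}_S}(v_k)\setminus\{v_0,\dots,v_k\}\ne\emptyset$, pick $v_{k+1}$ in this set uniformly at random and increase $k$ by 1. When this set is empty, pick $v_{k+1}=v_i$ with $v_i\in N^+_{\mathcal{P}_S}(v_k)$ and $k-i$ maximum, and stop. The cycle obtained is $v_i,v_{i+1},\dots,v_k,v_i$ (relabelled to start at $v_0$). The random choices of the algorithm are made independently of the weights. **Switching-signal construction.** Given a cycle $v_0,(v_0,v_1),v_1,\dots,v_{n-1},(v_{n-1},v_0),v_0$ obtained from the cycle detection algorithm and the $\Delta$ of the nicely $\Delta$-weighted property, set $\tau_0=0$ and, for $k=0,1,2,\dots$ and $p=kn,kn+1,\dots,(k+1)n-1$, set $\sigma(\tau_p)=v_{p-kn}$ and $\tau_{p+1}=\tau_p+\Delta$; $\sigma$ is constant on $[\tau_p,\tau_{p+1})\cap\mathbb{N}_0$. *)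

(* Defs.v *)
From HB Require Import structures.
From mathcomp Require Import all_boot all_order all_algebra.
From mathcomp Require Import all_classical all_reals all_analysis.

Set Implicit Arguments.
Unset Strict Implicit.
Unset Printing Implicit Defensive.

Import Order.TTheory GRing.Theory Num.Theory.
Import numFieldNormedType.Exports.

Local Open Scope classical_set_scope.
Local Open Scope ring_scope.

Section Comparison_functions.
Context {R : realType}.

(* Functions on [0, +oo[ are encoded as R -> R; their values at negative
   arguments are irrelevant.  That they map into [0, +oo[ follows. *)
Definition classK (phi : R -> R) : Prop :=
  [/\ {within `[0, +oo[%classic, continuous phi},
      {in `[0, +oo[ &, {homo phi : r s / r < s}} & phi 0 = 0].

Definition classKoo (phi : R -> R) : Prop :=
  classK phi /\ phi r @[r --> +oo] --> +oo.

Definition classKL (chi : R -> R -> R) : Prop :=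
  (forall s, 0 <= s -> classK (chi ^~ s)) /\
  (forall r, 0 <= r ->
     {in `[0, +oo[ &, {homo chi r : s t / s <= t >-> t <= s}} /\
     chi r s @[s --> +oo] --> (0 : R)).

End Comparison_functions.

Section Switched_systems.
Context {R : realType} {N d m p : nat}.

(* The norm carried by matrices in the library is the sup norm. *)
Definition enorm n (x : 'rV[R]_n) : R := Num.sqrt (\sum_(i < n) x ord0 i ^+ 2).

Definition sup_upto n (w : nat -> 'rV[R]_n) (t : nat) : R :=
  sup [set enorm (w s) | s in [set s | (s <= t)%N]].

Definition bounded_input (v : nat -> 'rV[R]_m) : Prop :=
  exists M : R, forall t, enorm (v t) <= M.

Definition IOSS (f : 'I_N -> 'rV[R]_d -> 'rV[R]_m -> 'rV[R]_d)
    (h : 'I_N -> 'rV[R]_d -> 'rV[R]_p) (sigma : nat -> 'I_N) : Prop :=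
  exists chi1 : R -> R -> R, exists chi2 chi3 : R -> R,
  [/\ classKL chi1, classK chi2, classK chi3 &
    forall (v : nat -> 'rV[R]_m) (x : nat -> 'rV[R]_d) (y : nat -> 'rV[R]_p),
      bounded_input v ->
      (forall t, x t.+1 = f (sigma t) (x t) (v t)) ->
      (forall t, y t = h (sigma t) (x t)) ->
      forall t, enorm (x t) <= chi1 (enorm (x 0%N)) t%:R
                                + chi2 (sup_upto v t) + chi3 (sup_upto y t)].

(* The index set {1, ..., N} is 'I_N; PS is the set of IOSS indices and the
   set PU of unstable (that is, not IOSS) indices is its complement. *)
Definition standing_assumptions (PS : {set 'I_N}) (E : {set 'I_N * 'I_N})
    (f : 'I_N -> 'rV[R]_d -> 'rV[R]_m -> 'rV[R]_d)
    (h : 'I_N -> 'rV[R]_d -> 'rV[R]_p)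
    (lam : 'I_N -> R) (mu : 'I_N -> 'I_N -> R) : Prop :=
  [/\ forall i xi, f i xi 0 = 0 <-> xi = 0,
      forall i, i \in PS <-> IOSS f h (fun=> i) &
    exists (V : 'I_N -> 'rV[R]_d -> R) (al au gamma1 gamma2 : R -> R),
    [/\ forall i, continuous (V i) /\ forall xi, 0 <= V i xi,
        [/\ classKoo al, classKoo au, classK gamma1 & classK gamma2],
        forall i, if i \in PS then 0 < lam i < 1 else 1 < lam i,
        forall i xi eta,
          [/\ al (enorm xi) <= V i xi, V i xi <= au (enorm xi) &
              V i (f i xi eta) <= lam i * V i xi + gamma1 (enorm eta)
                                  + gamma2 (enorm (h i xi))] &
        forall i j, (i, j) \in E ->
          1 <= mu i j /\ forall xi, V j xi <= mu i j * V i xi]].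

End Switched_systems.

Section Graph_and_signals.
Context {N : nat}.
Implicit Types (PS : {set 'I_N}) (E : {set 'I_N * 'I_N}).

(* tau 0 = 0 is not a time of change; tau 1 < tau 2 < ... enumerate exactly
   the times at which sigma changes its value. *)
Definition switching_instants (sigma : nat -> 'I_N) (tau : nat -> nat) : Prop :=
  [/\ tau 0%N = 0%N, forall k, (tau k < tau k.+1)%N &
      forall t, sigma t.+1 <> sigma t <-> exists k, t.+1 = tau k.+1].

Definition admissible E (Dm DM : nat) (sigma : nat -> 'I_N) : Prop :=
  exists2 tau, switching_instants sigma tau &
    forall k, (sigma (tau k), sigma (tau k.+1)) \in E /\
              (Dm <= tau k.+1 - tau k <= DM)%N.

Definition stable_out_nbrs PS E (v : 'I_N) : {set 'I_N} :=
  [set u in PS | (v, u) \in E]%SET.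

Definition nicely_connected {R : realType} PS E (Phi : nat -> R) : Prop :=
  forall j : 'I_N, Num.floor (Phi #|PS|) <= #|stable_out_nbrs PS E j|%:Z.

(* Probability that the algorithm, standing at v after having visited the
   vertices listed in [visited], visits next exactly the vertices of s, in this
   order, and then finds no unvisited stable out-neighbour. *)
Fixpoint walk_prob {R : realType} PS E (visited : seq 'I_N) (v : 'I_N)
    (s : seq 'I_N) : R :=
  let U := (stable_out_nbrs PS E v :\: [set u in visited])%SET in
  if s is u :: s' then
    (u \in U)%:R / #|U|%:R * walk_prob PS E (u :: visited) u s'
  else (#|U| == 0%N)%:R.

(* Probability that the vertices v_0, ..., v_k picked by the algorithm before
   the closing step are exactly those of s. *)
Definition trace_prob {R : realType} PS E (s : seq 'I_N) : R :=
  if s is v0 :: s' then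
    (v0 \in PS)%:R / #|PS|%:R * walk_prob PS E [:: v0] v0 s'
  else 0.

(* The closing vertex v_i maximizes k - i, i.e. it is the first vertex of the
   trace which is an out-neighbour of its last vertex.  The value is [::] when
   no vertex qualifies, which happens only if the last vertex has no stable
   out-neighbour at all. *)
Definition detected_cycle PS E (s : seq 'I_N) : seq 'I_N :=
  if s is v0 :: s' then
    drop (find (mem (stable_out_nbrs PS E (last v0 s'))) s) s
  else [::].

(* The cycle v_0, (v_0, v_1), ..., (v_{n-1}, v_0), v_0 is represented by the
   list c of its n vertices v_0, ..., v_{n-1}. *)
Definition constructed_signal (Delta : nat) (c : seq 'I_N)
    (sigma : nat -> 'I_N) : Prop :=
  let n := size c in
  exists2 tau : nat -> nat, tau 0%N = 0%N &
    forall k q, (k * n <= q < k.+1 * n)%N ->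
      [/\ onth c (q - k * n) = Some (sigma (tau q)),
          tau q.+1 = (tau q + Delta)%N &
          forall t, (tau q <= t < tau q.+1)%N -> sigma t = sigma (tau q)].

End Graph_and_signals.

Section Conditional_expectation.
Context {disp : measure_display} {T : measurableType disp} {R : realType}.
Variable P : probability T R.

Definition sigma_of (F : set (T -> R)) : set (set T) :=
  <<s [set X @^-1` B | X in F & B in (measurable : set (set R))] >>.

(* Y is a version of the conditional expectation of X given G. *)
Definition is_cond_exp (G : set (set T)) (X Y : T -> R) : Prop :=
  [/\ P.-integrable setT (EFin \o X), P.-integrable setT (EFin \o Y),
      forall B, measurable B -> G (Y @^-1` B) &
      forall A, G A -> (\int[P]_(om in A) (Y om)%:E
                        = \int[P]_(om in A) (X om)%:E)%E].

End Conditional_expectation.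

Section Random_weights.
Context {disp : measure_display} {T : measurableType disp} {R : realType}.
Context {N : nat}.
Variables (P : probability T R) (PS : {set 'I_N}) (E : {set 'I_N * 'I_N}).
Variables (lam : 'I_N -> {RV P >-> R}) (mu : 'I_N -> 'I_N -> {RV P >-> R}).

Definition vweight (j : 'I_N) (om : T) : R :=
  if j \in PS then - `|ln (lam j om)| else `|ln (lam j om)|.

Definition eweight (e : 'I_N * 'I_N) (om : T) : R := ln (mu e.1 e.2 om).

Definition abs_vweight (Delta : nat) (j : 'I_N) (om : T) : R :=
  `|vweight j om| * Delta%:R.

Definition nicely_weighted (Dm DM Delta : nat) (beta B A alpha : R) : Prop :=
  [/\ (Dm <= Delta <= DM)%N /\ 0 < beta < B,
      forall j,
        {ae P, forall om, 0 < abs_vweight Delta j om <= B} /\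
        exists2 Y, is_cond_exp P
            (sigma_of ([set abs_vweight Delta l | l in [set l | l != j]] `|`
                       [set eweight e | e in [set e | e \in E]]))
            (abs_vweight Delta j) Y &
          {ae P, forall om, Y om = beta},
      0 < A /\ alpha < beta &
      forall e, e \in E ->
        {ae P, forall om, - A <= eweight e om <= A} /\
        exists2 Y, is_cond_exp P
            (sigma_of ([set abs_vweight Delta l | l in [set: 'I_N]] `|`
                       [set eweight e' | e' in [set e' | e' \in E /\ e' != e]]))
            (eweight e) Y &
          {ae P, forall om, Y om <= alpha}].

(* [trace] is the random list of vertices v_0, ..., v_k picked by the cycle
   detection algorithm: it is always a possible execution, it has the law of
   the algorithm, and it is independent of the weights. *)
Definition cycle_detection_trace (trace : T -> seq 'I_N) : Prop :=
  [/\ forall om, 0 < trace_prob PS E (trace om) :> R,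
      forall s, measurable [set om | trace om = s],
      forall s, P [set om | trace om = s] = (trace_prob PS E s)%:E &
      forall s A,
        sigma_of ([set vweight l | l in [set: 'I_N]] `|`
                  [set eweight e | e in [set e | e \in E]]) A ->
        P (A `&` [set om | trace om = s])
        = (P A * P [set om | trace om = s])%E].

End Random_weights.

(* Main.v *)
(** Let c be the detected cycle, of length n.  Every stable out-neighbour of its
last vertex lies on it, so n is at least [Phi #|PS|] rounded down.  If the total
weight of c (log mu on the edges minus [|log lam| * Delta] on the vertices) is
negative, then the Lyapunov function of the active subsystem contracts over a
period of sigma, up to input and output terms, and sigma preserves IOSS.

Divide the contribution of the edge e and of its source, truncated to
[-(A + B), A + B], by A + B to get x_e, and let [u = (beta - alpha) / (A + B)].
Peeling off one edge at a time, the conditional expectations give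
[E (\prod_e (1 + u * x_e)) <= (1 - u ^+ 2) ^+ n], whereas convexity of exp gives
[\prod_e (1 + u * x_e) >= (1 - u ^+ 2) ^ (n / 2)] as soon as [\sum_e x_e >= 0].
By Markov's inequality a given cycle has nonnegative weight with probability at
most [(1 - u ^+ 2) ^ (n / 2) <= exp (- n * u ^+ 2 / 2)]; the trace of the
algorithm being independent of the weights, this bound passes to the random
cycle. *)

Require Import Defs.
From HB Require Import structures.
From mathcomp Require Import all_boot all_order all_algebra.
From mathcomp Require Import all_classical all_reals all_analysis.
From mathcomp Require Import measurable_realfun.
From mathcomp Require Import ring lra.

Set Implicit Arguments.
Unset Strict Implicit.
Unset Printing Implicit Defensive.

Import Order.TTheory GRing.Theory Num.Theory.
Import numFieldNormedType.Exports.

Local Open Scope classical_set_scope.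
Local Open Scope ring_scope.

(** * Executions of the cycle detection algorithm and the cycles they produce *)

Section Detected_cycle.
Context {N : nat}.
Implicit Types (PS : {set 'I_N}) (E : {set 'I_N * 'I_N}) (s c : seq 'I_N).

Definition edge E : rel 'I_N := fun u v => (u, v) \in E.

(** A nonzero product has nonzero factors, so each picked vertex was an unvisited stable
    out-neighbour of its predecessor. The list [rev s ++ vis] collects all vertices visited when the
    walk stops; the factor of the stopping test puts the remaining stable out-neighbours in it. *)
Lemma walk_prob_neq0 {R : realType} PS E vis v s :
  walk_prob PS E vis v s != 0 :> R ->
  [/\ path (edge E) v s, uniq s, all (fun u => u \notin vis) s,
      all (mem PS) s &
      {subset stable_out_nbrs PS E (last v s) <= rev s ++ vis}].
Proof.
elim: s vis v => [|u s IHs] vis v /=.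
  rewrite pnatr_eq0 eqb0 negbK cards_eq0 => /eqP/setP U0.
  split=> // w wv; have := U0 w.
  by rewrite !inE in wv *; rewrite wv andbT => /negbFE.
rewrite mulf_eq0 negb_or => /andP[U0 /IHs[pth us nvis sPS sub]].
have : u \in (stable_out_nbrs PS E v :\: [set x in vis])%SET.
  by apply: contraNT U0 => /negbTE ->; rewrite mul0r.
rewrite !inE => /andP[uvis /andP[uPS uE]]; split=> //=.
- by rewrite /edge /= uE.
- by rewrite us andbT; apply/negP => /(allP nvis); rewrite inE eqxx.
- rewrite uvis; apply/allP => w /(allP nvis); apply: contra => wv.
  by rewrite inE wv orbT.
- by rewrite uPS.
- by move=> w /sub; rewrite rev_cons cat_rcons.
Qed.

Lemma trace_prob_gt0 {R : realType} PS E s : 0 < trace_prob PS E s :> R ->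
  exists v s', [/\ s = v :: s', path (edge E) v s', uniq s, all (mem PS) s &
      {subset stable_out_nbrs PS E (last v s') <= s}].
Proof.
case: s => [|v s]; first by rewrite ltxx.
move/gt_eqF/negbT; rewrite mulf_eq0 negb_or => /andP[v0 /walk_prob_neq0].
case=> pth us nvis sPS sub; exists v, s; split => //=.
- by rewrite us andbT; apply/negP => /(allP nvis); rewrite inE eqxx.
- by rewrite sPS andbT; apply: contraNT v0 => /negbTE /= ->; rewrite mul0r.
- by move=> w /sub; rewrite mem_cat mem_rev !inE orbC.
Qed.

(** The cycle starts at the first vertex of the trace lying in [nb], the stable out-neighbourhood of
    the last vertex. Since [nb] is contained in the trace and nothing before that position belongs
    to it, all of [nb] lies on the cycle. *)
Lemma detected_cycleP {R : realType} PS E s :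
  (forall i j, (i, j) \in E -> i != j) ->
  0 < trace_prob PS E s :> R ->
  let c := detected_cycle PS E s in
  [/\ cycle (edge E) c, uniq c, all (mem PS) c &
      exists v, #|stable_out_nbrs PS E v| <= size c]%N.
Proof.
move=> Eirr /trace_prob_gt0[v [s' [es pth us sPS sub]]] c.
rewrite /c es /detected_cycle; set nb := stable_out_nbrs _ _ _ in sub *.
rewrite -es; set i := find (mem nb) s.
have lv : last v s' \notin nb.
  by rewrite !inE negb_and; apply/orP; right; apply/negP => /Eirr; rewrite eqxx.
have card_le : (#|nb| <= size (drop i s))%N.
  apply: leq_trans (card_size (drop i s)).
  apply/subset_leq_card/fintype.subsetP => w wnb.
  have := sub _ wnb; rewrite -{1}(cat_take_drop i s) mem_cat => /orP[|//].
  move=> wt; have := wnb.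
  have/(nthP v)[j jlt <-] := wt.
  have ji : (j < i)%N.
    by apply: (leq_trans jlt); rewrite size_take; case: ltnP.
  by rewrite nth_take//; have := before_find v ji; rewrite /= => ->.
split; last by exists (last v s').
(* If the search fails, the detected list is empty and the cycle condition holds trivially. *)
- have [is_|] := ltnP i (size s); last first.
    by move=> /drop_oversize ->.
  have hi : nth v s i \in nb.
    by apply: (@nth_find _ v (mem nb)); rewrite has_find.
  rewrite (drop_nth v is_) /= rcons_path.
  have := pth; rewrite -[path _ _ _]/(sorted (edge E) (v :: s')) -es.
  rewrite -{1}(cat_take_drop i s) => /cat_sorted2[_].
  rewrite (drop_nth v is_) /= => -> /=.
  suff -> : last (nth v s i) (drop i.+1 s) = last v s'.
    by move: hi; rewrite !inE => /andP[].
  have := last_cat v (take i s) (drop i s).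
  by rewrite cat_take_drop (drop_nth v is_) /= => <-; rewrite es.
- by rewrite drop_uniq.
- by apply/allP => w /mem_drop; apply: allP.
Qed.

End Detected_cycle.

(** * Periodicity and admissibility of the constructed signal *)

Section Constructed_signal.
Context {N : nat}.
Implicit Types (E : {set 'I_N * 'I_N}) (c : seq 'I_N) (sigma : nat -> 'I_N).

(** Induction on the clauses of the construction gives [tau q = q * Delta], so the time [t] falls in
    the dwell interval of index [t %/ Delta]. *)
Lemma constructed_signalE Delta c sigma v :
  (0 < Delta)%N -> (0 < size c)%N -> constructed_signal Delta c sigma ->
  forall t, sigma t = nth v c ((t %/ Delta) %% size c).
Proof.
move=> D0 c0 [tau tau0 tauP].
have tauP' q : [/\ onth c (q %% size c) = Some (sigma (tau q)),
          tau q.+1 = (tau q + Delta)%N &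
          forall t, (tau q <= t < tau q.+1)%N -> sigma t = sigma (tau q)].
  have := tauP (q %/ size c)%N q; rewrite leq_trunc_div -ltn_divLR// ltnS leqnn.
  have -> : (q - q %/ size c * size c = q %% size c)%N.
    by rewrite {1}(divn_eq q (size c)) addKn.
  by move=> /(_ isT).
have tauE q : tau q = (q * Delta)%N.
  by elim: q => [//|q IHq]; have [_ -> _] := tauP' q; rewrite IHq mulSn addnC.
move=> t; have [on _ ->] := tauP' (t %/ Delta)%N.
  by move: on; rewrite -(odflt_onth v) => ->.
by rewrite !tauE leq_divM/= ltn_ceil.
Qed.

Lemma nth_modS_next c v i : uniq c -> (0 < size c)%N ->
  nth v c (i.+1 %% size c) = next c (nth v c (i %% size c)).
Proof.
move=> uc c0; have lt_i := ltn_pmod i c0.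
rewrite next_nth mem_nth// index_uniq//.
case: c uc c0 lt_i => // x c _ _ /= lt_i.
rewrite -addn1 -modnDml; move: lt_i.
rewrite ltnS leq_eqVlt => /orP[/eqP ->|lt_i].
  by rewrite addn1 modnn [RHS]nth_default.
by rewrite addn1 modn_small//=; apply: set_nth_default.
Qed.

(** Consecutive active subsystems are joined by an edge, and [E] has no loops; hence the signal
    really changes at every positive multiple of [Delta], and nowhere else. *)
Lemma constructed_signal_admissible Delta E Dm DM c sigma :
  (forall i j, (i, j) \in E -> i != j) ->
  cycle (edge E) c -> uniq c -> c != [::] ->
  (0 < Delta)%N -> (Dm <= Delta <= DM)%N ->
  constructed_signal Delta c sigma -> admissible E Dm DM sigma.
Proof.
move=> Eirr cyc uc cn0 D0 DD.
have c0 : (0 < size c)%N by rewrite lt0n size_eq0.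
case: c cyc uc c0 {cn0} => // v c'; set c := v :: c' => cyc uc c0.
move=> /(constructed_signalE v D0 c0) sigmaE.
have sE q : (sigma (q * Delta)%N, sigma (q.+1 * Delta)%N) \in E.
  rewrite !sigmaE !mulnK// nth_modS_next//.
  by apply: (next_cycle cyc); rewrite mem_nth// ltn_pmod.
exists (fun q => q * Delta)%N; last first.
  by move=> k; split => //; rewrite -mulnBl subSnn mul1n.
split=> // [k|t]; first by rewrite ltn_pmul2r.
have neq q : sigma (q.+1 * Delta)%N <> sigma (q * Delta)%N.
  by move=> eq_; have := Eirr _ _ (sE q); rewrite eq_ eqxx.
split=> [st|[k tE]].
  have [/dvdnP[[|k] tE]|ndvd] := boolP (Delta %| t.+1)%N; first by [].
    by exists k.
  case: st; rewrite !sigmaE; do 2 f_equal.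
  by rewrite divnS// (negbTE ndvd).
have tk : (t %/ Delta = k)%N.
  by have := divnS t D0; rewrite tE mulnK// dvdn_mull// => -[].
by rewrite tE => eq_; apply: (neq k); rewrite eq_ !sigmaE mulnK// tk.
Qed.

End Constructed_signal.

(** * Calculus of class K, K-infinity and KL functions *)

Section Comparison_functions_theory.
Context {R : realType}.
Implicit Types (f g phi al : R -> R) (r s t z e : R).

Lemma within_itvcy_continuousP f : {within `[0, +oo[%classic, continuous f} <->
  forall z e, 0 <= z -> 0 < e ->
    exists2 dl, 0 < dl & forall t, 0 <= t -> `|z - t| < dl -> `|f z - f t| < e.
Proof.
split=> [/subspace_continuousP cf z e z0 e0|H].
  have := cf z; rewrite /= in_itv/= andbT => /(_ z0)/cvgrPdist_lt/(_ _ e0).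
  rewrite near_withinE => -[dl /= dl0 sub]; exists dl => // t t0 zt.
  by apply: sub => //=; rewrite in_itv/= t0.
apply/subspace_continuousP => z /=; rewrite in_itv/= andbT => z0.
apply/cvgrPdist_lt => e e0; have [dl dl0 Hdl] := H z e z0 e0.
rewrite near_withinE; exists dl => // t /= zt; rewrite in_itv/= andbT => t0.
exact: Hdl.
Qed.

Lemma classK_lt phi r s : classK phi -> 0 <= r -> r < s -> phi r < phi s.
Proof.
move=> [_ inc _] r0 rs; apply: inc => //; rewrite in_itv/= ?r0// andbT.
exact: ltW (le_lt_trans r0 rs).
Qed.

Lemma classK_le phi r s : classK phi -> 0 <= r -> r <= s -> phi r <= phi s.
Proof.
by move=> K r0; rewrite le_eqVlt => /predU1P[->//|rs]; exact/ltW/classK_lt.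
Qed.

Lemma classK_ge0 phi r : classK phi -> 0 <= r -> 0 <= phi r.
Proof. by move=> K r0; have [_ _ {1}<-] := K; exact: classK_le. Qed.

Lemma classK_comp f g : classK f -> classK g -> classK (f \o g).
Proof.
move=> Kf Kg; have [cf _ f0] := Kf; have [cg _ g0] := Kg; split.
- apply/within_itvcy_continuousP => z e z0 e0.
  have gz0 := classK_ge0 Kg z0.
  have [dl dl0 Hf] := (within_itvcy_continuousP f).1 cf _ _ gz0 e0.
  have [dl' dl'0 Hg] := (within_itvcy_continuousP g).1 cg _ _ z0 dl0.
  exists dl' => // t t0 zt; apply: Hf; first exact: classK_ge0.
  exact: Hg.
- move=> r s; rewrite !in_itv/= !andbT => r0 s0 rs.
  by apply: classK_lt => //; [exact: classK_ge0|exact: classK_lt].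
- by rewrite /= g0.
Qed.

Lemma classK_scale a f : 0 < a -> classK f -> classK (fun r => a * f r).
Proof.
move=> a0 Kf; have [cf _ f0] := Kf; split; last by rewrite f0 mulr0.
- apply/within_itvcy_continuousP => z e z0 e0.
  have ea0 : 0 < e / a by rewrite divr_gt0.
  have [dl dl0 Hf] := (within_itvcy_continuousP f).1 cf _ _ z0 ea0.
  exists dl => // t t0 zt; have := Hf t t0 zt.
  by rewrite -mulrBr normrM (gtr0_norm a0) ltr_pdivlMr// mulrC.
- move=> r s; rewrite !in_itv/= !andbT => r0 s0 rs.
  by rewrite ltr_pM2l//; exact: classK_lt.
Qed.

(** Unboundedness and the intermediate value theorem make [al] onto [0, +oo[; strict monotonicity
    orders and makes continuous any right inverse. The last clause turns a bound on [al] of a norm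
    into a bound on the norm. *)
Lemma classKoo_inverse al : classKoo al -> exists g,
  [/\ classK g, forall z, 0 <= z -> al (g z) = z &
      forall r z, 0 <= r -> 0 <= z -> al r <= z -> r <= g z].
Proof.
move=> [K /cvgryPge aloo]; have [cal _ al0] := K.
have inv z : exists r, 0 <= z -> 0 <= r /\ al r = z.
  have [z0|] := boolP (0 <= z); last by exists 0.
  have [M [_ HM]] := aloo z.
  (* This point is nonnegative and exceeds [M], beyond which [al] is at least [z]. *)
  pose b := `|M| + 1.
  have b0 : 0 <= b by rewrite addr_ge0.
  have zb : z <= al b by apply: HM; rewrite (le_lt_trans (ler_norm M)) ?ltrDl.
  have [||r] := @IVT R al 0 b z b0.
  - apply: continuous_subspaceW cal => r /=; rewrite !in_itv/=.
    by case/andP => ->.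
  - by rewrite al0 ge_min z0/= le_max zb orbT.
  by rewrite in_itv/= => /andP[r0 _] alr; exists r => _.
have [g Hg] := choice inv.
have g_ge0 z : 0 <= z -> 0 <= g z by move=> /Hg[].
have gK z : 0 <= z -> al (g z) = z by move=> /Hg[].
have lt_g r z : 0 <= r -> 0 <= z -> al r < z -> r < g z.
  move=> r0 z0; rewrite !ltNge; apply: contraNN => gr.
  by rewrite -(gK z)//; apply: classK_le => //; exact: g_ge0.
have g_lt r z : 0 <= r -> 0 <= z -> z < al r -> g z < r.
  move=> r0 z0; rewrite !ltNge; apply: contraNN => gr.
  by rewrite -(gK z)//; apply: classK_le => //; exact: g_ge0.
have le_g r z : 0 <= r -> 0 <= z -> al r <= z -> r <= g z.
  move=> r0 z0; rewrite !leNgt; apply: contraNN => gr.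
  by rewrite -{1}(gK z)//; apply: classK_lt => //; exact: g_ge0.
exists g; split => //; split.
- apply/within_itvcy_continuousP => z e z0 e0.
  have up : z < al (g z + e).
    by rewrite -{1}(gK z)//; apply: classK_lt; rewrite ?ltrDl ?g_ge0.
  have gze0 : 0 <= g z + e by rewrite addr_ge0 ?g_ge0 // ltW.
  (* When [g z < e], the point [g z - e] is negative and cannot be fed to [al]; the lower estimate
     then follows from [0 <= g t]. *)
  have [eg|ge] := leP e (g z).
    have lo : al (g z - e) < z.
      by rewrite -{2}(gK z)//; apply: classK_lt;
        rewrite ?subr_ge0 ?gtrDl ?oppr_lt0.
    exists (Num.min (z - al (g z - e)) (al (g z + e) - z)).
      by rewrite lt_min !subr_gt0 lo.
    move=> t t0; rewrite lt_min !ltr_norml => /andP[/andP[? ?] /andP[? ?]].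
    have ? : g t < g z + e by apply: g_lt => //; lra.
    have ? : g z - e < g t by apply: lt_g; [rewrite subr_ge0|done|lra].
    by apply/andP; split; lra.
  exists (al (g z + e) - z); first by rewrite subr_gt0.
  move=> t t0; rewrite !ltr_norml => /andP[? ?].
  have ? : g t < g z + e by apply: g_lt => //; lra.
  have ? := g_ge0 t t0.
  by apply/andP; split; lra.
- move=> r s; rewrite !in_itv/= !andbT => r0 s0 rs.
  by apply: lt_g; rewrite ?g_ge0// gK.
- apply/eqP; rewrite eq_le g_ge0// andbT leNgt; apply/negP => g0.
  by have := classK_lt K (lexx 0) g0; rewrite gK// al0 ltxx.
Qed.

(** This is the shape of the transient term in the IOSS estimate. Continuity of [g] at 0 carries the
    exponential decay in [s] through [g]. *)
Lemma classKL_exp_decay g au C k : 0 < C -> 0 < k -> classK g -> classK au ->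
  classKL (fun r s => g (C * expR (- (k * s)) * au r)).
Proof.
move=> C0 k0 Kg Kau.
have a0 s : 0 < C * expR (- (k * s)) by rewrite mulr_gt0 ?expR_gt0.
split=> [s _|r r0].
  by apply: (classK_comp Kg); exact: classK_scale.
have aur := classK_ge0 Kau r0.
split=> [s t _ _ st|].
  apply: classK_le => //; first by rewrite mulr_ge0 // ltW.
  by rewrite ler_wpM2r// ler_pM2l// ler_expR lerN2 ler_pM2l.
have [cg _ g0] := Kg.
apply/cvgrPdist_lt => e e0.
have [dl dl0 Hdl] := (within_itvcy_continuousP g).1 cg 0 e (lexx _) e0.
have cvg0 : C * expR (- (k * s)) * au r @[s --> +oo] --> C * 0 * au r.
  apply: cvgMl; apply: cvgMr.
  apply: (@cvg_comp _ _ _ (fun s => k * s) (fun x => expR (- x)) _ +oo).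
    by apply: gt0_cvgMry => //; exact: cvg_id.
  exact: cvgr_expR.
move/cvgrPdist_lt : cvg0 => /(_ _ dl0); rewrite mulr0 mul0r.
apply: filterS => s Hs; rewrite -g0; apply: Hdl => //.
by rewrite mulr_ge0 // ltW.
Qed.

End Comparison_functions_theory.

(** * A comparison principle for periodic linear recursions *)

Section Periodic_comparison.
Context {R : realType}.

(* Dividing by the potential [p t = (\prod_(s < t) a s) / q ^+ t], with q ^+ L
   the product of a over one period, turns the recursion into a contraction of
   constant ratio q; p is periodic, hence bounded from above and below. *)
Lemma periodic_recursion_bound (a : nat -> R) (L : nat) (b : R) :
  (forall t, 0 < a t) -> (forall t, a (t + L)%N = a t) -> (0 < L)%N ->
  \prod_(0 <= t < L) a t < 1 -> 0 < b ->
  exists C k D : R, [/\ 0 < C, 0 < k, 0 < D &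
    forall (W : nat -> R) (u : R) (t : nat), 0 <= u -> 0 <= W 0%N ->
      (forall s, (s < t)%N -> W s.+1 <= a s * W s + b * u) ->
      W t <= C * expR (- (k * t%:R)) * W 0%N + D * u].
Proof.
move=> a0 aL L0 rho1 b0; set rho := \prod_(_ <= _ < _) _ in rho1.
have rho0 : 0 < rho by apply: prodr_gt0.
pose k := - ln rho / L%:R.
have L0' : 0 < L%:R :> R by rewrite ltr0n.
have k0 : 0 < k by rewrite divr_gt0// oppr_gt0 ln_lt0// rho0.
pose q := expR (- k).
have q0 : 0 < q by exact: expR_gt0.
have q1 : q < 1 by rewrite -expR0 ltr_expR oppr_lt0.
have qX t : expR (- (k * t%:R)) = q ^+ t.
  by rewrite -mulNr -expRM_natr.
have qL : q ^+ L = rho.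
  by rewrite -qX /k mulfVK ?gt_eqF// opprK lnK.
pose p t := (\prod_(0 <= s < t) a s) / q ^+ t.
have p0 t : 0 < p t by rewrite divr_gt0 ?exprn_gt0// prodr_gt0.
have pS t : p t.+1 = p t * (a t / q).
  by rewrite /p big_nat_recr//= exprS invfM; ring.
have pL t : p (t + L)%N = p t.
  elim: t => [|t IHt]; last by rewrite addSn !pS IHt aL.
  by rewrite add0n /p -/rho qL divff ?gt_eqF// big_geq// expr0 divr1.
have pM t : p t = p (t %% L)%N.
  rewrite {1}(divn_eq t L) addnC; elim: (t %/ L)%N => [|n IHn].
    by rewrite mul0n addn0.
  by rewrite mulSn (addnC L) addnA pL.
(* As all terms are positive, a sum over one period dominates each of them and replaces a
   maximum. *)
pose pmax := \sum_(0 <= s < L) p s; pose pinv := \sum_(0 <= s < L) (p s)^-1.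
have sum_ge (g : nat -> R) t : (forall s, 0 < g s) ->
    g (t %% L)%N <= \sum_(0 <= s < L) g s.
  move=> g0; rewrite big_mkord (bigD1 (Ordinal (ltn_pmod t L0)))//= lerDl.
  by apply: sumr_ge0 => i _; exact: ltW.
have p_le t : p t <= pmax by rewrite pM; exact: sum_ge.
have pinv_le t : (p t)^-1 <= pinv.
  by rewrite pM; apply: (sum_ge (fun s => (p s)^-1)) => s; rewrite invr_gt0.
have pmax0 : 0 < pmax by exact: lt_le_trans (p_le 0%N).
have pinv0 : 0 < pinv by apply: lt_le_trans (pinv_le 0%N); rewrite invr_gt0.
have q1' : 0 < 1 - q by rewrite subr_gt0.
exists pmax, k, (pmax * (b * pinv / (1 - q))); split => //.
  by apply: mulr_gt0 => //; apply: divr_gt0 => //; exact: mulr_gt0.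
move=> W u t u0 W0 WS; rewrite qX.
(* [K] is the fixed point of [K = q * K + b * u * pinv], the rescaled recursion with constant
   forcing. *)
pose K := b * pinv / (1 - q) * u.
have K0 : 0 <= K by rewrite mulr_ge0// ltW// divr_gt0// mulr_gt0.
have main s : (s <= t)%N -> W s <= p s * (q ^+ s * W 0%N + K).
  elim: s => [_|s IHs st].
    by rewrite /p big_geq// expr0 divr1 !mul1r lerDl.
  apply: (le_trans (WS s st)).
  apply: (@le_trans _ _ (a s * (p s * (q ^+ s * W 0%N + K)) + b * u)).
    by rewrite lerD2r ler_pM2l//; apply: IHs; exact: ltnW.
  have bu : b * u <= p s.+1 * (b * u * pinv).
    rewrite mulrCA ler_peMr//; first by rewrite mulr_ge0// ltW.
    by rewrite -(mulfV (lt0r_neq0 (p0 s.+1)))// ler_pM2l.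
  apply: (le_trans (lerD (lexx _) bu)).
  have Kq : b * u * pinv = K * (1 - q).
    by rewrite /K; field; rewrite gt_eqF.
  rewrite Kq pS exprS.
  rewrite le_eqVlt; apply/orP; left; apply/eqP; field; rewrite gt_eqF//.
apply: (le_trans (main t (leqnn _))).
apply: (@le_trans _ _ (pmax * (q ^+ t * W 0%N + K))).
  by rewrite ler_wpM2r// addr_ge0// mulr_ge0// exprn_ge0// ltW.
by rewrite /K mulrDr !mulrA.
Qed.

End Periodic_comparison.

(** * Running suprema of norms *)

Section Sup_upto.
Context {R : realType} {n : nat}.
Implicit Types w : nat -> 'rV[R]_n.

Lemma enorm_ge0 (x : 'rV[R]_n) : 0 <= enorm x.
Proof. exact: sqrtr_ge0. Qed.

Lemma le_sup_upto w s t : (s <= t)%N -> enorm (w s) <= sup_upto w t.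
Proof.
move=> st; apply: ub_le_sup; last by exists s.
(* The sum of the finitely many norms is an upper bound, so that [sup] is a genuine supremum. *)
exists (\sum_(0 <= i < t.+1) enorm (w i)) => _ [i /= it <-].
rewrite big_mkord (bigD1 (Ordinal (n:=t.+1) (m:=i) it))//= lerDl.
by apply: sumr_ge0 => j _; exact: enorm_ge0.
Qed.

Lemma sup_upto_ge0 w t : 0 <= sup_upto w t.
Proof. exact: le_trans (enorm_ge0 _) (le_sup_upto w (leq0n t)). Qed.

End Sup_upto.

(** * From a contractive cycle to input/output-to-state stability *)

Section IOSS_of_cycle.
Context {R : realType}.

(** The sum of three numbers is at most three times the largest, and the other two terms on the
    right are nonnegative. *)
Lemma classK_add3_le (g : R -> R) (r s t : R) :
  classK g -> 0 <= r -> 0 <= s -> 0 <= t ->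
  g (r + s + t) <= g (3 * r) + g (3 * s) + g (3 * t).
Proof.
move=> Kg r0 s0 t0.
have [? ? ?] : [/\ 0 <= g (3 * r), 0 <= g (3 * s) & 0 <= g (3 * t)].
  by split; apply: (classK_ge0 Kg); rewrite mulr_ge0.
have rst0 : 0 <= r + s + t by rewrite !addr_ge0.
have [sr|rs] := leP s r.
  have [tr|rt] := leP t r.
    have : g (r + s + t) <= g (3 * r) by apply: classK_le => //; lra.
    by lra.
  have : g (r + s + t) <= g (3 * t) by apply: classK_le => //; lra.
  by lra.
have [ts|st] := leP t s.
  have : g (r + s + t) <= g (3 * s) by apply: classK_le => //; lra.
  by lra.
have : g (r + s + t) <= g (3 * t) by apply: classK_le => //; lra.
by lra.
Qed.

(** A period splits into [size c] blocks of length [Delta]. Each block carries [Delta] equal factors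
    [lam], and one factor [mu] at its last time, where [t.+1] is a multiple of [Delta]. *)
Lemma periodic_signal_prod {N : nat} (lam : 'I_N -> R) (mu : 'I_N -> 'I_N -> R)
    (Delta : nat) (c : seq 'I_N) (v : 'I_N) (sigma : nat -> 'I_N) :
  uniq c -> (0 < Delta)%N ->
  (forall t, sigma t = nth v c ((t %/ Delta) %% size c)) ->
  \prod_(0 <= t < size c * Delta) (lam (sigma t) *
      (if (Delta %| t.+1)%N then mu (sigma t) (sigma t.+1) else 1)) =
  \prod_(u <- c) (lam u ^+ Delta * mu u (next c u)).
Proof.
move=> uc D0 sigmaE; rewrite big_nat_mul (big_nth v) big_nat [RHS]big_nat.
apply: eq_bigr => i /andP[_ ic]; have c0 := leq_trans (ltn0Sn i) ic.
have sE j : (j < Delta)%N -> sigma (j + i * Delta)%N = nth v c i.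
  by move=> jD; rewrite sigmaE addnC divnMDl// divn_small// addn0 modn_small.
rewrite mulSn -{1}[(i * Delta)%N]add0n big_addn addnK.
case: Delta D0 sigmaE sE => // D _ sigmaE sE.
rewrite big_nat_recr//= (@eq_big_nat _ _ _ _ _ _ (fun=> lam (nth v c i))).
  rewrite prodr_const_nat subn0 sE// -addSn -mulSn dvdn_mull//.
  by rewrite sigmaE mulnK// nth_modS_next// modn_small// mulrA -exprSr.
move=> j /andP[_ jD]; rewrite sE; last by rewrite ltnS ltnW.
by rewrite -addSn dvdn_addl ?dvdn_mull// gtnNdvd// mulr1.
Qed.

(** Along a trajectory, [V (sigma t) (x t)] obeys a recursion with periodic coefficients [a t],
    whose product over a period is the exponential of the weight of the cycle, hence less than 1. *)
Lemma IOSS_of_contractive_cycle {N d m p : nat} (PS : {set 'I_N})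
    (E : {set 'I_N * 'I_N})
    (f : 'I_N -> 'rV[R]_d -> 'rV[R]_m -> 'rV[R]_d)
    (h : 'I_N -> 'rV[R]_d -> 'rV[R]_p)
    (lam : 'I_N -> R) (mu : 'I_N -> 'I_N -> R) (Delta : nat) (c : seq 'I_N)
    (sigma : nat -> 'I_N) :
  standing_assumptions PS E f h lam mu ->
  cycle (edge E) c -> uniq c -> all (mem PS) c -> (0 < Delta)%N ->
  constructed_signal Delta c sigma ->
  \sum_(u <- c) (ln (mu u (next c u)) - `|ln (lam u)| * Delta%:R) < 0 ->
  IOSS f h sigma.
Proof.
move=> [_ _ [V [al [au [g1 [g2 [V0 [Kal [Kau _] Kg1 Kg2] lamP VP muP]]]]]]].
move=> cyc uc cPS D0 sigma_constr sum0.
have c0 : (0 < size c)%N.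
  by case: (c) sum0; rewrite // big_nil ltxx.
have [v _] : exists v, v \in c.
  case: (c) c0 => // v c' _; exists v; exact: mem_head.
have sigmaE := constructed_signalE v D0 c0 sigma_constr.
have edgeE u : u \in c -> (u, next c u) \in E by move=> /(next_cycle cyc).
have sE t : (Delta %| t.+1)%N -> (sigma t, sigma t.+1) \in E.
  move=> dv; rewrite !sigmaE divnS// dv add1n nth_modS_next//.
  by apply: edgeE; rewrite mem_nth// ltn_pmod.
have sN t : ~~ (Delta %| t.+1)%N -> sigma t.+1 = sigma t.
  by move=> /negbTE dv; rewrite !sigmaE divnS// dv.
have lam0 i : 0 < lam i.
  by have := lamP i; case: ifP => _ => [/andP[]//|]; exact: lt_trans.
pose mt t := if (Delta %| t.+1)%N then mu (sigma t) (sigma t.+1) else 1.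
have mt1 t : 1 <= mt t by rewrite /mt; case: ifP => // /sE/muP[].
have mt0 t : 0 < mt t by exact: lt_le_trans ltr01 (mt1 t).
have mtV t xi : V (sigma t.+1) xi <= mt t * V (sigma t) xi.
  rewrite /mt; case: ifPn => [/sE/muP[_]//|/sN ->]; by rewrite mul1r.
(* A bound on all switching factors [mt t], uniform in time; it multiplies the input and output
   terms. *)
pose b := 1 + \sum_i \sum_j `|mu i j|.
have b_ge t : mt t <= b.
  rewrite /mt /b; case: ifP => _; last first.
    by rewrite lerDl; apply: sumr_ge0 => i _; apply: sumr_ge0.
  rewrite (bigD1 (sigma t))//= (bigD1 (sigma t.+1))//=.
  have S1 : 0 <= \sum_(j | j != sigma t.+1) `|mu (sigma t) j|.
    by apply: sumr_ge0.
  have S2 : 0 <= \sum_(i | i != sigma t) \sum_j `|mu i j|.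
    by apply: sumr_ge0 => i _; apply: sumr_ge0.
  by have := ler_norm (mu (sigma t) (sigma t.+1)); lra.
have b0 : 0 < b by exact: lt_le_trans (mt0 0%N) (b_ge 0%N).
pose a t := lam (sigma t) * mt t.
have a0 t : 0 < a t by rewrite mulr_gt0.
have sP t : sigma (t + size c * Delta)%N = sigma t.
  by rewrite !sigmaE addnC divnMDl// modnDl.
have aP t : a (t + size c * Delta)%N = a t.
  by rewrite /a /mt -addSn !sP dvdn_addl// dvdn_mull.
have rho1 : \prod_(0 <= t < size c * Delta) a t < 1.
  rewrite (periodic_signal_prod _ _ uc D0 sigmaE).
  have -> : \prod_(u <- c) (lam u ^+ Delta * mu u (next c u)) =
      expR (\sum_(u <- c) (ln (mu u (next c u)) - `|ln (lam u)| * Delta%:R)).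
    rewrite (big_morph expR (@expRD R) (@expR0 R)) big_seq [RHS]big_seq.
    apply: eq_bigr => u uc'.
    have uPS : u \in PS by have /allP/(_ _ uc') := cPS.
    have := lamP u; rewrite uPS => /andP[lu0 lu1].
    have [mu1 _] := muP _ _ (edgeE u uc').
    rewrite ler0_norm ?ln_le0 ?ltW// mulNr opprK expRD mulrC.
    by rewrite lnK ?posrE ?(lt_le_trans _ mu1)// expRM_natr lnK.
  by rewrite expR_lt1.
have L0 : (0 < size c * Delta)%N by rewrite muln_gt0 c0.
have [C [k [D [C0 k0 D0' WP]]]] := periodic_recursion_bound a0 aP L0 rho1 b0.
have [g [Kg _ le_g]] := classKoo_inverse Kal.
have C30 : 0 < 3 * C by rewrite mulr_gt0.
have D30 : 0 < 3 * D by rewrite mulr_gt0.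
(* The factors 3 come from splitting [g] of a sum of three terms with [classK_add3_le]. *)
exists (fun r s => g (3 * C * expR (- (k * s)) * au r)).
exists (g \o (fun r => 3 * D * g1 r)), (g \o (fun r => 3 * D * g2 r)).
split.
- exact: classKL_exp_decay.
- by apply: classK_comp => //; exact: classK_scale.
- by apply: classK_comp => //; exact: classK_scale.
move=> w x y _ xS yE t /=.
have gw0 := classK_ge0 Kg1 (sup_upto_ge0 w t).
have gy0 := classK_ge0 Kg2 (sup_upto_ge0 y t).
pose u := g1 (sup_upto w t) + g2 (sup_upto y t).
have V0' i xi : 0 <= V i xi by have [_] := V0 i.
have Wt : V (sigma t) (x t) <=
    C * expR (- (k * t%:R)) * V (sigma 0%N) (x 0%N) + D * u.
  apply: (WP (fun s => V (sigma s) (x s))) => // [|s st].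
    by rewrite addr_ge0.
  (* The state moves under subsystem [sigma s] first; the change of Lyapunov function is paid for at
     the new state. *)
  apply: (le_trans (mtV _ _)); rewrite xS.
  have [_ _ step] := VP (sigma s) (x s) (w s).
  apply: (@le_trans _ _ (mt s * (lam (sigma s) * V (sigma s) (x s) + u))).
    rewrite ler_pM2l// (le_trans step)// -addrA lerD2l lerD//.
      by apply: classK_le => //; [exact: enorm_ge0|exact/le_sup_upto/ltnW].
    rewrite -yE; apply: classK_le => //; first exact: enorm_ge0.
    exact/le_sup_upto/ltnW.
  rewrite mulrDr /a mulrCA mulrA lerD2l ler_wpM2r// ?addr_ge0//.
have [al_le _ _] := VP (sigma t) (x t) 0.
have [_ le_au _] := VP (sigma 0%N) (x 0%N) 0.
have e0 : 0 < C * expR (- (k * t%:R)) by rewrite mulr_gt0// expR_gt0.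
have au0 : 0 <= au (enorm (x 0%N)) by apply: classK_ge0 => //; exact: enorm_ge0.
have tot : al (enorm (x t)) <= C * expR (- (k * t%:R)) * au (enorm (x 0%N))
    + D * g1 (sup_upto w t) + D * g2 (sup_upto y t).
  apply: (le_trans al_le); apply: (le_trans Wt).
  by rewrite /u mulrDr addrA !lerD2r ler_pM2l.
have [z1 z2 z3] : [/\ 0 <= C * expR (- (k * t%:R)) * au (enorm (x 0%N)),
    0 <= D * g1 (sup_upto w t) & 0 <= D * g2 (sup_upto y t)].
  by split; apply: mulr_ge0 => //; exact: ltW.
apply: le_trans (le_g _ _ (enorm_ge0 _) _ tot) _; first by rewrite !addr_ge0.
by apply: (le_trans (classK_add3_le Kg z1 z2 z3)); rewrite !mulrA.
Qed.

End IOSS_of_cycle.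

(** * Measurability with respect to a generated sub-sigma-algebra *)

Section Sub_sigma_algebra.
Context {disp : measure_display} {T : measurableType disp} {R : realType}.
Implicit Types (F : set (T -> R)) (X G : T -> R).

Definition generators F : set (set T) :=
  [set X @^-1` B | X in F & B in (measurable : set (set R))].

(** Viewing [X] on the type whose sigma-algebra is [sigma_of F] makes the closure properties of
    [measurable_fun] available for the sub-sigma-algebra. *)
Definition measurable_wrt F X :=
  measurable_fun [set: g_sigma_algebraType (generators F)] X.

Lemma measurable_wrt_mem F X : F X -> measurable_wrt F X.
Proof.
move=> FX _ B mB; rewrite setTI; apply: sub_sigma_algebra.
by exists X => //; exists B.
Qed.

Lemma measurable_wrt_preimage F X B : measurable_wrt F X -> measurable B ->
  sigma_of F (X @^-1` B).
Proof. by move=> mX mB; rewrite -[_ @^-1` _]setTI; exact: mX. Qed.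

Lemma sigma_of_measurable F A : (forall X, F X -> measurable_fun setT X) ->
  sigma_of F A -> measurable A.
Proof.
move=> mF; apply: smallest_sub => [|_ [X FX [B mB <-]]].
  exact: sigma_algebra_measurable.
by rewrite -[X @^-1` B]setTI; exact: mF.
Qed.

Lemma measurable_wrt_fun F X : (forall X, F X -> measurable_fun setT X) ->
  measurable_wrt F X -> measurable_fun setT X.
Proof.
move=> mF mX _ B mB; rewrite setTI; apply: (sigma_of_measurable mF).
exact: measurable_wrt_preimage.
Qed.

End Sub_sigma_algebra.

(** * Integral inequalities from bounds on conditional expectations *)

Section Conditional_expectation_bounds.
Context {disp : measure_display} {T : measurableType disp} {R : realType}.
Variable P : probability T R.
Implicit Types (F : set (T -> R)) (X Y Z G : T -> R) (r M : R).

Lemma integrable_mulr_bounded X G M : measurable_fun setT G ->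
  (forall x, `|G x| <= M) -> P.-integrable setT (EFin \o X) ->
  P.-integrable setT (EFin \o (fun x => G x * X x)).
Proof.
move=> mG GM iX.
have bG : [bounded G x | x in [set: T]].
  exists M; split; first exact: num_real.
  by move=> M' MM' x _ /=; rewrite (le_trans (GM x))// ltW.
have -> : EFin \o (fun x => G x * X x) = ((EFin \o G) \* (EFin \o X))%E.
  by apply/funext => x /=; rewrite EFinM.
exact: integrableMr.
Qed.

Lemma integrable_bounded G M : measurable_fun setT G ->
  (forall x, `|G x| <= M) -> P.-integrable setT (EFin \o G).
Proof.
move=> mG GM; apply: measurable_bounded_integrable => //.
  by rewrite [X in (X < _)%E]probability_setT ltry.
exists M; split; first exact: num_real.
by move=> M' MM' x _ /=; rewrite (le_trans (GM x))// ltW.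
Qed.

Lemma integrable_funB D X Y : measurable D -> P.-integrable D (EFin \o X) ->
  P.-integrable D (EFin \o Y) ->
  P.-integrable D (EFin \o (fun x => X x - Y x)).
Proof.
move=> mD iX iY; have -> : EFin \o (fun x => X x - Y x) =
    ((EFin \o X) \- (EFin \o Y))%E by apply/funext => x.
exact: integrableB.
Qed.

Lemma Rintegral_cst_proba (r : R) : \int[P]_x r = r.
Proof.
by rewrite /Rintegral integral_cst//= [X in (_ * X)%E]probability_setT mule1.
Qed.

Lemma Rintegral_indic_mul X A : measurable A ->
  \int[P]_x (\1_A x * X x) = \int[P]_(x in A) X x.
Proof.
move=> mA; rewrite [RHS]Rintegral_mkcond; apply: eq_Rintegral => x _.
by rewrite patchE indicE; case: ifP => xA; rewrite ?mul1r ?mul0r.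
Qed.

(* Splitting off [(M / 2) \1_{G >= M / 2}] halves the bound on G, and the part
   split off contributes a nonpositive amount; iterating, the integral is at most
   [M / 2 ^ k * \int |Z|] for every k. *)
Lemma Rintegral_mul_le0 F Z G M :
  (forall X, F X -> measurable_fun setT X) ->
  P.-integrable setT (EFin \o Z) ->
  (forall A, sigma_of F A -> \int[P]_(x in A) Z x <= 0) ->
  measurable_wrt F G -> (forall x, 0 <= G x <= M) ->
  \int[P]_x (G x * Z x) <= 0.
Proof.
move=> mF iZ Zle mG GM.
have iaZ := integrable_norm iZ.
set K := \int[P]_x `|Z x|.
have K0 : 0 <= K by apply: Rintegral_ge0.
have M0 : 0 <= M.
  (* A space of total mass 1 has a point, and at that point [0 <= G x0 <= M]. *)
  have [x0 _] : exists x : T, True.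
    apply: contrapT => noT; have := probability_setT P.
    have -> : [set: T] = set0.
      by apply/seteqP; split=> x // _; case: noT; exists x.
    by rewrite measure0 => /eqP; rewrite eq_sym onee_eq0.
  by have /andP[g0 gM] := GM x0; exact: le_trans gM.
have main k : forall G (M : R), 0 <= M -> measurable_wrt F G ->
    (forall x, 0 <= G x <= M) ->
    \int[P]_x (G x * Z x) <= M / 2 ^+ k * K.
  elim: k => [|k IHk] {GM M0 mG M}{}G M M0 mG GM.
    have GM' x : `|G x| <= M by have /andP[g0 gM] := GM x; rewrite ger0_norm.
    have mG' := measurable_wrt_fun mF mG.
    rewrite expr0 divr1 -RintegralZl//.
    apply: le_Rintegral => //.
    - exact: (integrable_mulr_bounded mG' GM' iZ).
    - apply: (@integrable_mulr_bounded _ (fun=> M) M) => // x.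
      by rewrite ger0_norm.
    - move=> x _; apply: (le_trans (ler_norm _)); rewrite normrM.
      by rewrite ler_wpM2r.
  pose A := G @^-1` `[M / 2, +oo[%classic.
  have FA : sigma_of F A by exact: measurable_wrt_preimage.
  have mA := sigma_of_measurable mF FA.
  have M20 : 0 <= M / 2 by rewrite divr_ge0.
  pose G' x := G x - M / 2 * \1_A x.
  have m1 : measurable_wrt F (\1_A : T -> R).
    rewrite /measurable_wrt; apply: measurable_indic; exact: FA.
  have mG' : measurable_wrt F G'.
    apply: measurable_funB => //; apply: measurable_funM => //.
  have AE x : (x \in A) = (M / 2 <= G x).
    by apply/idP/idP; rewrite inE /A /= in_itv/= andbT.
  have G'M x : 0 <= G' x <= M / 2.
    have /andP[g0 gM] := GM x; rewrite /G' indicE AE.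
    case: (leP (M / 2) (G x)) => h.
      by rewrite mulr1; apply/andP; split; lra.
    by rewrite mulr0; apply/andP; split; lra.
  have iG' : P.-integrable setT (EFin \o (fun x => G' x * Z x)).
    apply: (@integrable_mulr_bounded _ _ (M / 2)) => //.
      exact: measurable_wrt_fun mG'.
    by move=> x; have /andP[? ?] := G'M x; rewrite ger0_norm.
  have i1 : P.-integrable setT (EFin \o (fun x => \1_A x * Z x)).
    apply: (@integrable_mulr_bounded _ _ 1) => //.
    by move=> x; rewrite indicE; case: (_ \in _); rewrite ?normr1 ?normr0.
  have i2 : P.-integrable setT (EFin \o (fun x => M / 2 * (\1_A x * Z x))).
    apply: (@integrable_mulr_bounded _ (fun=> M / 2) (M / 2)) => //.
    by move=> x; rewrite ger0_norm.
  have -> : \int[P]_x (G x * Z x) =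
      \int[P]_x (G' x * Z x + M / 2 * (\1_A x * Z x)).
    by apply: eq_Rintegral => x _; rewrite /G'; ring.
  rewrite RintegralD// RintegralZl// Rintegral_indic_mul//.
  have := IHk G' (M / 2) M20 mG' G'M.
  have : M / 2 * \int[P]_(x in A) Z x <= 0 by rewrite mulr_ge0_le0// Zle.
  by rewrite exprS invfM mulrA; lra.
rewrite leNgt; apply/negP; set I := \int[P]_x _ => I0.
have MK0 : 0 <= M * K / I by rewrite !mulr_ge0// invr_ge0 ltW.
(* As [k < 2 ^ k], such a [k] makes [M / 2 ^+ k * K] smaller than [I], against [main]. *)
have [k kP] : exists k : nat, M * K / I < k%:R.
  by exists (Num.bound (M * K / I)); exact: archi_boundP.
have := main k G M M0 mG GM; rewrite -/I leNgt => /negP; apply.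
rewrite mulrAC ltr_pdivrMr ?exprn_gt0// -ltr_pdivrMl// mulrC.
by apply: (lt_trans kP); rewrite -natrX ltr_nat ltn_expl//.
Qed.

(** Over an event of the conditioning sigma-algebra, [X] and its version [Y] have the same integral,
    and [Y <= r] almost everywhere. *)
Lemma is_cond_exp_integral_le F X Y (r : R) A :
  (forall X, F X -> measurable_fun setT X) ->
  is_cond_exp P (sigma_of F) X Y -> {ae P, forall x, Y x <= r} ->
  sigma_of F A -> \int[P]_(x in A) (X x - r) <= 0.
Proof.
move=> mF [iX iY mY XY] Yr FA; have mA := sigma_of_measurable mF FA.
have iXA := integrableS measurableT mA (@subsetT _ _) iX.
have iYA := integrableS measurableT mA (@subsetT _ _) iY.
have ir : P.-integrable setT (EFin \o (fun=> r)).
  by apply: (@integrable_bounded _ `|r|).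
have irA := integrableS measurableT mA (@subsetT _ _) ir.
have -> : \int[P]_(x in A) (X x - r) = \int[P]_(x in A) (Y x - r).
  by rewrite !RintegralB// /Rintegral XY.
rewrite -oppr_ge0 -mulN1r -RintegralZl//; last exact: integrable_funB.
have mYm : measurable_fun setT Y.
  move=> _ B mB; rewrite setTI.
  by apply: (sigma_of_measurable mF); exact: mY.
rewrite /Rintegral (@ae_eq_integral _ _ _ P A (fun x => `|Y x - r|%:E))//.
- by apply: fine_ge0; apply: integral_ge0 => x _; rewrite lee_fin.
- apply/measurable_EFinP; apply: measurable_funTS.
  by apply: measurable_funM => //; exact: measurable_funB.
- apply/measurable_EFinP; apply: measurable_funTS.
  by apply: measurableT_comp => //; exact: measurable_funB.
- apply: filterS Yr => x Yx _; congr EFin.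
  by rewrite ler0_norm ?subr_le0// mulN1r.
Qed.

(** The conditional expectation concerns the weight [X] itself, while the product under study
    contains its truncation [Z]; they agree almost everywhere. The rest is [Rintegral_mul_le0]
    applied to [X - r]. *)
Lemma is_cond_exp_mul_le F X Y Z G (r M : R) :
  (forall X, F X -> measurable_fun setT X) ->
  is_cond_exp P (sigma_of F) X Y -> {ae P, forall x, Y x <= r} ->
  measurable_fun setT X -> measurable_fun setT Z ->
  {ae P, forall x, X x = Z x} ->
  measurable_wrt F G -> (forall x, 0 <= G x <= M) ->
  \int[P]_x (G x * Z x) <= r * \int[P]_x G x.
Proof.
move=> mF XY Yr mX mZ XZ mG GM; have [iX _ _ _] := XY.
have GM' x : `|G x| <= M by have /andP[? ?] := GM x; rewrite ger0_norm.
have mG' := measurable_wrt_fun mF mG.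
have ir : P.-integrable setT (EFin \o (fun=> r)).
  by apply: (@integrable_bounded _ `|r|).
have -> : \int[P]_x (G x * Z x) = \int[P]_x (G x * X x).
  rewrite /Rintegral; congr fine; apply: ae_eq_integral => //.
  - by apply/measurable_EFinP; exact: measurable_funM.
  - by apply/measurable_EFinP; exact: measurable_funM.
  - by apply: filterS XZ => x -> _.
have iXr := integrable_funB measurableT iX ir.
have := Rintegral_mul_le0 mF iXr
  (fun A FA => is_cond_exp_integral_le mF XY Yr FA) mG GM.
have -> : \int[P]_x (G x * (X x - r)) = \int[P]_x (G x * X x - r * G x).
  by apply: eq_Rintegral => x _; ring.
have iG := integrable_bounded mG' GM'.
rewrite RintegralB//; last 2 first.
- exact: integrable_mulr_bounded iX.
- by apply: (@integrable_mulr_bounded _ (fun=> r) `|r|).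
by rewrite RintegralZl// subr_le0.
Qed.

(** Negation lets the upper bound above serve also as a lower bound for the vertex weights. *)
Lemma is_cond_expN F X Y : (forall X, F X -> measurable_fun setT X) ->
  is_cond_exp P (sigma_of F) X Y ->
  is_cond_exp P (sigma_of F) (\- X) (\- Y).
Proof.
move=> mF [iX iY mY XY].
have Ng W : P.-integrable setT (EFin \o W) ->
    P.-integrable setT (EFin \o (\- W)).
  move=> iW; have -> : EFin \o (\- W) = (\- (EFin \o W))%E.
    by apply/funext => x.
  exact: integrableN.
split; [exact: Ng|exact: Ng| |].
- move=> B mB; rewrite -[_ @^-1` _]/(Y @^-1` (-%R @^-1` B)).
  by apply: mY; rewrite -[X in measurable X]setTI; exact: oppr_measurable.
- move=> A FA; have mA := sigma_of_measurable mF FA.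
  have iXA := integrableS measurableT mA (@subsetT _ _) iX.
  have iYA := integrableS measurableT mA (@subsetT _ _) iY.
  have NE W : P.-integrable A (EFin \o W) ->
      (\int[P]_(x in A) ((\- W) x)%:E = - \int[P]_(x in A) (W x)%:E)%E.
    move=> iW; rewrite -(integralN (integrable_add_def mA iW)).
    by apply: eq_integral.
  by rewrite !NE// XY.
Qed.

End Conditional_expectation_bounds.

(** * A lower bound for products of affine factors *)

Section Cycle_weight.
Context {disp : measure_display} {T : measurableType disp} {R : realType}.

(* Convexity of exp on the segment between [ln (1 - u)] and [ln (1 + u)]. *)
Lemma prod_affine_ge (I : eqType) (s : seq I) (x : I -> R) (u : R) :
  0 <= u < 1 -> (forall i, i \in s -> `|x i| <= 1) -> 0 <= \sum_(i <- s) x i ->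
  expR (ln (1 - u ^+ 2) / 2) ^+ size s <= \prod_(i <- s) (1 + u * x i).
Proof.
move=> /andP[u0 u1] x1 sum0.
have up : 0 < 1 + u by lra.
have um : 0 < 1 - u by lra.
(* [k] is half the length of the segment, whose midpoint is [ln (1 - u ^+ 2) / 2]. Since [k] and the
   sum of the [x i] are nonnegative, adding the terms [k * x i] in the exponents only increases the
   product. *)
pose k := (ln (1 + u) - ln (1 - u)) / 2.
have k0 : 0 <= k by rewrite divr_ge0// subr_ge0 ler_ln ?posrE//; lra.
have -> : expR (ln (1 - u ^+ 2) / 2) ^+ size s =
    \prod_(i <- s) expR (ln (1 - u ^+ 2) / 2).
  by rewrite big_const_seq count_predT iter_mulr_1.
apply: (@le_trans _ _ (\prod_(i <- s) expR (ln (1 - u ^+ 2) / 2 + k * x i))).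
  rewrite -!(big_morph expR (@expRD R) (@expR0 R)) ler_expR big_split/=.
  by rewrite -[X in _ <= _ + X]mulr_sumr lerDl mulr_ge0.
rewrite big_seq [leRHS]big_seq; apply: ler_prod => i si; rewrite expR_ge0/=.
have := x1 i si; rewrite ler_norml => /andP[xm xp].
have t0 : 0 <= (1 + x i) / 2 by rewrite divr_ge0//; lra.
have t1 : (1 + x i) / 2 <= 1 by rewrite ler_pdivrMr//; lra.
have := @convex_expR R (Itv01 t0 t1) (ln (1 + u)) (ln (1 - u)).
rewrite !convRE/= /unstable.onem !lnK ?posrE//.
have -> : 1 - u ^+ 2 = (1 + u) * (1 - u) by ring.
rewrite lnM ?posrE//.
set a := ln _; set b := ln _ => h.
have -> : (a + b) / 2 + k * x i = (1 + x i) / 2 * a + (1 - (1 + x i) / 2) * b.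
  by rewrite /k -/a -/b; field.
by apply: (le_trans h); rewrite le_eqVlt; apply/orP; left; apply/eqP; field.
Qed.

End Cycle_weight.

(** * Tail bound for the weight of a fixed cycle *)

Section Cycle_weight_tail.
Context {disp : measure_display} {T : measurableType disp} {R : realType}.
Context {N : nat} {P : probability T R}.
Context {PS : {set 'I_N}} {E : {set 'I_N * 'I_N}}.
Context {lam : 'I_N -> {RV P >-> R}} {mu : 'I_N -> 'I_N -> {RV P >-> R}}.
Context {Dm DM Delta : nat} {beta B A alpha : R}.
Context (weighted :
  nicely_weighted PS E lam mu Dm DM Delta beta B A alpha).

Let Z := abs_vweight PS lam Delta.
Let W := eweight mu.

(** [FZ j] and [FW e] are the families conditioned upon in [nicely_weighted]: every weight except
    that of the vertex [j], respectively of the edge [e]. *)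
Let FZ (j : 'I_N) : set (T -> R) :=
  [set Z l | l in [set l | l != j]] `|` [set W e | e in [set e | e \in E]].
Let FW (e : 'I_N * 'I_N) : set (T -> R) :=
  [set Z l | l in [set: 'I_N]] `|`
  [set W e' | e' in [set e' | e' \in E /\ e' != e]].

Lemma measurable_vweight j : measurable_fun setT (vweight PS lam j).
Proof.
have m : measurable_fun setT (fun om => `|ln (lam j om)|).
  by apply: measurableT_comp => //; apply: measurableT_comp => //;
    exact: measurable_ln.
rewrite /vweight; case: (j \in PS) => //.
exact: measurable_funN.
Qed.

Lemma measurable_abs_vweight j : measurable_fun setT (Z j).
Proof.
apply: measurable_funM => //; apply: measurableT_comp => //.
exact: measurable_vweight.
Qed.

Lemma measurable_eweight e : measurable_fun setT (W e).
Proof. by apply: measurableT_comp => //; exact: measurable_ln. Qed.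

Let mFZ j X : FZ j X -> measurable_fun setT X.
Proof.
case=> [[l _ <-]|[e _ <-]]; first exact: measurable_abs_vweight.
exact: measurable_eweight.
Qed.

Let mFW e X : FW e X -> measurable_fun setT X.
Proof.
case=> [[l _ <-]|[e' _ <-]]; first exact: measurable_abs_vweight.
exact: measurable_eweight.
Qed.

(* The weights are bounded only almost surely; their truncations are bounded
   everywhere. *)
Let Zc j om := Num.min (Z j om) B.
Let Wc e om := Num.max (- A) (Num.min (W e om) A).

Let A0 : 0 < A. Proof. by have [_ _ []] := weighted. Qed.
Let B0 : 0 < B.
Proof. by have [[_ /andP[b0 bB]] _ _ _] := weighted; exact: lt_trans bB. Qed.

Let Zc_itv j om : 0 <= Zc j om <= B.
Proof.
rewrite /Zc le_min ge_min lexx orbT andbT (ltW B0) andbT.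
by rewrite /Z /abs_vweight mulr_ge0.
Qed.

Let Wc_itv e om : - A <= Wc e om <= A.
Proof.
rewrite /Wc le_max lexx/= ge_max ge_min lexx orbT andbT.
by have := A0; lra.
Qed.

Let ZcE j : {ae P, forall om, Z j om = Zc j om}.
Proof.
have [_ /(_ j)[+ _] _ _] := weighted; apply: filterS => om /andP[_ ZB].
by rewrite /Zc min_l.
Qed.

Let WcE e : e \in E -> {ae P, forall om, W e om = Wc e om}.
Proof.
move=> eE; have [_ _ _ /(_ e eE)[+ _]] := weighted.
apply: filterS => om /andP[AW WA].
by rewrite /Wc min_l// max_r.
Qed.

Let measurable_Zc F j : F (Z j) -> measurable_wrt F (Zc j).
Proof.
by move=> FZj; apply: measurable_minr => //; exact: measurable_wrt_mem.
Qed.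

Let measurable_Wc F e : F (W e) -> measurable_wrt F (Wc e).
Proof.
move=> FWe; apply: measurable_maxr => //; apply: measurable_minr => //.
exact: measurable_wrt_mem.
Qed.

Let mZc j : measurable_fun setT (Zc j).
Proof.
by apply: measurable_minr => //; exact: measurable_abs_vweight.
Qed.

Let mWc e : measurable_fun setT (Wc e).
Proof.
apply: measurable_maxr => //; apply: measurable_minr => //.
exact: measurable_eweight.
Qed.

Lemma Rintegral_mul_eweight_le e G M : e \in E ->
  measurable_wrt (FW e) G -> (forall om, 0 <= G om <= M) ->
  \int[P]_om (G om * Wc e om) <= alpha * \int[P]_om G om.
Proof.
move=> eE mG GM; have [_ _ _ /(_ e eE)[_ [Y YP Ya]]] := weighted.
apply: (is_cond_exp_mul_le (@mFW e) YP Ya _ _ _ mG GM) => //.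
  exact: measurable_eweight.
exact: WcE.
Qed.

Lemma Rintegral_mul_vweight_ge j G M :
  measurable_wrt (FZ j) G -> (forall om, 0 <= G om <= M) ->
  beta * \int[P]_om G om <= \int[P]_om (G om * Zc j om).
Proof.
move=> mG GM; have [_ /(_ j)[_ [Y YP Yb]] _ _] := weighted.
have YPN := is_cond_expN (@mFZ j) YP.
have GM' om : `|G om| <= M by have /andP[? ?] := GM om; rewrite ger0_norm.
have Yb' : {ae P, forall om, (\- Y) om <= - beta}.
  by apply: filterS Yb => om /= ->.
have := is_cond_exp_mul_le (Z := \- Zc j) (@mFZ j) YPN Yb' _ _ _ mG GM.
have -> : \int[P]_om (G om * (\- Zc j) om) = - \int[P]_om (G om * Zc j om).
  rewrite -mulN1r -RintegralZl//; first by apply: eq_Rintegral => om _ /=; ring.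
  apply: (@integrable_mulr_bounded _ _ _ _ _ _ M) => //.
    exact: (measurable_wrt_fun (@mFZ j)).
  apply: (@integrable_bounded _ _ _ _ _ B) => // om.
  by have /andP[? ?] := Zc_itv j om; rewrite ger0_norm.
rewrite mulNr lerN2; apply.
- by apply: measurable_funN; exact: measurable_abs_vweight.
- exact: measurable_funN.
- by apply: filterS (ZcE j) => om ZE; congr (- _).
Qed.

(** The constant multiplier 1 bounds the mean of an edge weight by [alpha], and this mean is at
    least [- A]. Together with [beta < B] this yields [u < 1]. *)
Lemma alpha_ge e : e \in E -> - A <= alpha.
Proof.
move=> eE.
have := @Rintegral_mul_eweight_le e (fun=> 1) 1 eE.
rewrite Rintegral_cst_proba mulr1 => h; apply: le_trans (h _ _).
- rewrite -[leLHS](Rintegral_cst_proba P); apply: le_Rintegral => //.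
  + by apply: (@integrable_bounded _ _ _ _ _ `|- A|).
  + apply: (@integrable_bounded _ _ _ _ _ A) => // [|om].
      by apply: measurable_funM.
    by rewrite mul1r ler_norml.
  + by move=> om _; rewrite mul1r; have /andP[] := Wc_itv e om.
- by apply: measurable_cst.
- by move=> _; rewrite ler01 lexx.
Qed.

Let u := (beta - alpha) / (A + B).

Let u_ge0 : 0 <= u.
Proof.
have [_ _ [_ ab] _] := weighted.
by rewrite divr_ge0// ?subr_ge0 ?ltW// addr_gt0.
Qed.

Let u_lt1 e : e \in E -> u < 1.
Proof.
move=> /alpha_ge Aa; have [[_ /andP[_ bB]] _ _ _] := weighted.
by rewrite ltr_pdivrMr ?addr_gt0// mul1r; lra.
Qed.

Let x (e : 'I_N * 'I_N) om : R := (Wc e om - Zc e.1 om) / (A + B).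

Let x_le1 e om : `|x e om| <= 1.
Proof.
have AB : 0 < A + B by rewrite addr_gt0.
rewrite /x normrM normfV (gtr0_norm AB) ler_pdivrMr// mul1r ler_norml.
have /andP[? ?] := Zc_itv e.1 om; have /andP[? ?] := Wc_itv e om.
by have ? := B0; apply/andP; split; lra.
Qed.

Let H (s : seq ('I_N * 'I_N)) om := \prod_(e <- s) (1 + u * x e om).

Let H_itv s om : all (mem E) s -> 0 <= H s om <= 2 ^+ size s.
Proof.
elim: s => [|e s IHs]; first by rewrite /H big_nil expr0 ler01 lexx.
move=> /= /andP[eE /IHs/andP[h0 h2]]; rewrite /H big_cons -/(H s om) exprS.
have u1 := u_lt1 eE.
have : `|u * x e om| <= 1 by rewrite normrM mulr_ile1// ger0_norm// ltW.
rewrite ler_norml => /andP[? ?].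
rewrite mulr_ge0//=; last by lra.
by apply: ler_pM => //; lra.
Qed.

Let measurable_H F s : (forall e, e \in s -> F (W e) /\ F (Z e.1)) ->
  measurable_wrt F (H s).
Proof.
move=> Fs; apply: measurable_prod => e es; have [FWe FZe] := Fs e es.
apply: measurable_funD => //; apply: measurable_funM => //.
apply: measurable_funM => //; apply: measurable_funB.
  exact: measurable_Wc.
exact: measurable_Zc.
Qed.

(** Distinct sources keep both weights of the head edge out of [H s], which is therefore measurable
    for both conditioning families. The two bounds then extract the factor [1 + k * (alpha - beta)],
    that is [1 - u ^+ 2]. *)
Lemma Rintegral_prod_le s : all (mem E) s -> uniq (map fst s) ->
  \int[P]_om H s om <= (1 - u ^+ 2) ^+ size s.
Proof.
elim: s => [_ _|e s IHs /= /andP[eE sE] /andP[es us]].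
  rewrite expr0 -[leRHS](Rintegral_cst_proba P).
  rewrite le_eqVlt; apply/orP; left; apply/eqP/eq_Rintegral => om _.
  by rewrite /H big_nil.
have mHZ : measurable_wrt (FZ e.1) (H s).
  apply: measurable_H => e' e's; split.
    by right; exists e' => //; have /allP := sE; exact.
  left; exists e'.1 => //=; apply: contraNneq es => <-; exact: map_f.
have mHW : measurable_wrt (FW e) (H s).
  apply: measurable_H => e' e's; split; last by left; exists e'.1.
  right; exists e' => //=; split; first by have /allP := sE; exact.
  by apply: contraNneq es => <-; exact: map_f.
have Hs om := H_itv om sE.
have mH := measurable_wrt_fun (@mFW e) mHW.
have Hs' om : `|H s om| <= 2 ^+ size s.
  by have /andP[? ?] := Hs om; rewrite ger0_norm.
have iH := integrable_bounded P mH Hs'.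
have iZ : P.-integrable setT (EFin \o (fun om => H s om * Zc e.1 om)).
  apply: (integrable_mulr_bounded mH Hs').
  apply: (@integrable_bounded _ _ _ _ _ B) => // om.
  by have /andP[? ?] := Zc_itv e.1 om; rewrite ger0_norm.
have iW : P.-integrable setT (EFin \o (fun om => H s om * Wc e om)).
  apply: (integrable_mulr_bounded mH Hs').
  by apply: (@integrable_bounded _ _ _ _ _ A) => // om; rewrite ler_norml.
have AB : 0 < A + B by rewrite addr_gt0.
pose k := u / (A + B).
have k0 : 0 <= k by rewrite divr_ge0// ltW.
have iD := integrable_funB measurableT iW iZ.
have ikD : P.-integrable setT
    (EFin \o (fun om => k * (H s om * Wc e om - H s om * Zc e.1 om))).
  by apply: (@integrable_mulr_bounded _ _ _ _ _ (fun=> k) `|k|).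
have -> : \int[P]_om H (e :: s) om = \int[P]_om (H s om
    + k * (H s om * Wc e om - H s om * Zc e.1 om)).
  by apply: eq_Rintegral => om _; rewrite /H big_cons /x /k; ring.
rewrite RintegralD// RintegralZl// RintegralB//.
have hW := Rintegral_mul_eweight_le eE mHW Hs.
have hZ := Rintegral_mul_vweight_ge mHZ Hs.
set I := \int[P]_om H s om in hW hZ *.
have I0 : 0 <= I by apply: Rintegral_ge0 => om _; have /andP[] := Hs om.
apply: (@le_trans _ _ (I + k * (alpha * I - beta * I))).
  by rewrite lerD2l ler_wpM2l// lerB.
have -> : I + k * (alpha * I - beta * I) = (1 - u ^+ 2) * I.
  by rewrite /k /u; field; rewrite gt_eqF.
rewrite [leRHS]exprS ler_wpM2l ?IHs//.
by rewrite subr_ge0 expr_le1// ltW// (u_lt1 eE).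
Qed.

Let sum_xE s : all (mem E) s ->
  {ae P, forall om, \sum_(e <- s) (W e om - Z e.1 om) =
                    (A + B) * \sum_(e <- s) x e om}.
Proof.
elim: s => [_|e s IHs /= /andP[eE /IHs{}IHs]].
  by apply: aeW => om; rewrite !big_nil mulr0.
apply: filterS3 (WcE eE) (ZcE e.1) IHs => om We Ze se.
rewrite !big_cons se We Ze /x; field.
by rewrite gt_eqF// addr_gt0.
Qed.

Lemma cycle_weight_tail s : all (mem E) s -> uniq (map fst s) ->
  (P [set om | (0 <= \sum_(e <- s) (W e om - Z e.1 om))%R] <=
   (expR (- (1 / 2 * ((alpha - beta) / (A + B)) ^+ 2 * (size s)%:R)))%:E)%E.
Proof.
move=> sE us.
have -> : ((alpha - beta) / (A + B)) ^+ 2 = u ^+ 2.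
  by rewrite -sqrrN -mulNr opprB.
pose D := [set om | 0 <= \sum_(e <- s) (W e om - Z e.1 om)].
have mset (f : T -> R) : measurable_fun setT f ->
    measurable [set om | 0 <= f om].
  move=> mf.
  have -> : [set om | 0 <= f om] = setT `&` f @^-1` `[0, +oo[%classic.
    by rewrite setTI; apply/seteqP; split=> om /=; rewrite in_itv/= andbT.
  exact: mf.
have mD : measurable D.
  apply: mset; apply: measurable_sum => e.
  apply: measurable_funB; first exact: measurable_eweight.
  exact: measurable_abs_vweight.
(* The inequality [u < 1] is obtained from an edge; for the empty list the bound is 1. *)
have [s0|[e0 e0s]] : s = [::] \/ exists e0, e0 \in s.
  by case: (s) => [|e s']; [left|right; exists e; rewrite mem_head].
  by rewrite s0 mulr0 oppr0 expR0 -s0; exact: probability_le1.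
have u1 : u < 1 by apply: (@u_lt1 e0); move/allP : sE; exact.
have u2 : 0 < 1 - u ^+ 2 by rewrite subr_gt0 exprn_ilt1.
have AB : 0 < A + B by rewrite addr_gt0.
set r := expR (ln (1 - u ^+ 2) / 2).
have r2 : r ^+ 2 = 1 - u ^+ 2.
  by rewrite /r -expRM_natr divfK// lnK.
have r0 : 0 < r by exact: expR_gt0.
(* [D'] is the event [D] for the truncated, rescaled weights; the two differ by a null set. *)
pose D' := [set om | 0 <= \sum_(e <- s) x e om].
have mD' : measurable D'.
  apply: mset; apply: measurable_sum => e.
  by apply: measurable_funM => //; exact: measurable_funB.
have PD : P D = (\int[P]_om \1_D' om)%:E.
  rewrite -[D]setIT -integral_indic// /Rintegral fineK; last first.
    by rewrite integral_indic// setIT fin_num_measure.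
  apply: ae_eq_integral => //; [exact/measurable_EFinP|exact/measurable_EFinP|].
  apply: filterS (sum_xE sE) => om DE _; rewrite !indicE.
  suff -> : (om \in D) = (om \in D') by [].
  by apply/idP/idP; rewrite !inE /D /D' /= DE pmulr_rge0.
rewrite PD lee_fin.
have mH : measurable_fun setT (H s).
  apply: measurable_prod => e _; apply: measurable_funD => //.
  apply: measurable_funM => //; apply: measurable_funM => //.
  exact: measurable_funB.
have HM om : `|H s om| <= 2 ^+ size s.
  by have /andP[? ?] := H_itv om sE; rewrite ger0_norm.
have i1 : P.-integrable setT (EFin \o (\1_D' : T -> R)).
  apply: (@integrable_bounded _ _ _ _ _ 1) => // om.
  by rewrite indicE; case: (_ \in _); rewrite ?normr1 ?normr0.
have markov : r ^+ size s * \int[P]_om \1_D' om <= \int[P]_om H s om.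
  rewrite -RintegralZl//; apply: le_Rintegral => //.
  - set q := r ^+ size s.
    by apply: (@integrable_mulr_bounded _ _ _ _ _ (fun=> q) `|q|).
  - exact: integrable_bounded HM.
  - move=> om _; rewrite indicE; case: (boolP (om \in D')) => [|_]; last first.
      by rewrite mulr0; have /andP[] := H_itv om sE.
    rewrite inE /D' /= => sum0; rewrite mulr1 /r; apply: prod_affine_ge => //.
    by rewrite u_ge0.
have : r ^+ size s * \int[P]_om \1_D' om <= r ^+ size s * r ^+ size s.
  apply: (le_trans markov); apply: (le_trans (Rintegral_prod_le sE us)).
  by rewrite -exprD addnn -mul2n exprM r2.
rewrite ler_pM2l ?exprn_gt0// => /le_trans; apply.
have -> : - (1 / 2 * u ^+ 2 * (size s)%:R) = - (u ^+ 2 / 2) * (size s)%:R.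
  by field.
rewrite expRM_natr lerXn2r ?nnegrE ?expR_ge0//.
rewrite /r ler_expR -[leRHS]mulNr ler_pM2r//.
(* What remains is [1 - u ^+ 2 <= expR (- u ^+ 2)], after taking logarithms. *)
rewrite -[leRHS]expRK ler_ln ?posrE ?expR_gt0//.
exact: expR_ge1Dx.
Qed.

End Cycle_weight_tail.

(** * Tail bound for the cycle detected from a given trace *)

Section Detected_cycle_weight.
Context {disp : measure_display} {T : measurableType disp} {R : realType}.
Context {N : nat} {P : probability T R}.
Context {PS : {set 'I_N}} {E : {set 'I_N * 'I_N}}.
Context {lam : 'I_N -> {RV P >-> R}} {mu : 'I_N -> 'I_N -> {RV P >-> R}}.
Context {Dm DM Delta : nat} {beta B A alpha : R}.

Definition cycle_edges (c : seq 'I_N) : seq ('I_N * 'I_N) :=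
  [seq (v, next c v) | v <- c].

Lemma all_cycle_edges c : cycle (edge E) c -> all (mem E) (cycle_edges c).
Proof.
by move=> cyc; apply/allP => _ /mapP[v vc ->]; exact: next_cycle cyc vc.
Qed.

Lemma fst_cycle_edges c : [seq e.1 | e <- cycle_edges c] = c.
Proof. by rewrite -map_comp map_id. Qed.

(** The vertices of a detected cycle are stable, which is why their absolute weights enter with a
    minus sign. *)
Definition cycle_weight (c : seq 'I_N) (om : T) : R :=
  \sum_(e <- cycle_edges c) (eweight mu e om - abs_vweight PS lam Delta e.1 om).

Lemma cycle_weightE c om : cycle_weight c om =
  \sum_(v <- c) (ln (mu v (next c v) om) - `|ln (lam v om)| * Delta%:R).
Proof.
rewrite /cycle_weight big_map; apply: eq_bigr => v _.
rewrite /abs_vweight /vweight /eweight/=.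
by case: ifP => _; rewrite ?normrN normr_id.
Qed.

(** With [Delta = 0] the quantity [abs_vweight] would vanish identically, whereas it is almost
    surely positive on a space of mass 1. *)
Lemma dwell_time_gt0 (v : 'I_N) :
  nicely_weighted PS E lam mu Dm DM Delta beta B A alpha -> (0 < Delta)%N.
Proof.
move=> [_ /(_ v)[[Nu [mNu Nu0 sub]] _] _ _]; rewrite lt0n.
apply/eqP => D0; have : P [set: T] = 0%E.
  rewrite -Nu0; congr (P _); apply/seteqP; split=> // om _; apply: sub => /=.
  by rewrite /abs_vweight D0 mulr0 ltxx.
by move/eqP; rewrite probability_setT onee_eq0.
Qed.

Lemma sigma_of_cycle_weight c : all (mem E) (cycle_edges c) ->
  sigma_of ([set vweight PS lam l | l in [set: 'I_N]] `|`
            [set eweight mu e | e in [set e | e \in E]])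
    [set om | 0 <= cycle_weight c om].
Proof.
move=> cE; set F := _ `|` _.
have -> : [set om | 0 <= cycle_weight c om] =
    cycle_weight c @^-1` `[0, +oo[%classic.
  by apply/seteqP; split=> om /=; rewrite in_itv/= andbT.
apply: measurable_wrt_preimage => //.
rewrite /measurable_wrt /cycle_weight.
(* Terms outside the list become 0, so only weights of edges in [E] have to be measurable for
   [F]. *)
under eq_fun => om do rewrite big_seq big_mkcond.
apply: measurable_sum => e; case: (boolP (e \in cycle_edges c)) => // ec.
apply: measurable_funB.
  by apply: measurable_wrt_mem; right; exists e => //; move/allP : cE; exact.
apply: measurable_funM => //; apply: measurableT_comp => //.
by apply: measurable_wrt_mem; left; exists e.1.
Qed.

(** Once the trace is fixed the cycle is deterministic. The factor [P [set om | trace om = s]],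
    split off by independence, is kept so that summation over [s] gives total mass 1. *)
Lemma detected_cycle_tail (Phi : nat -> R) (trace : T -> seq 'I_N)
    (s : seq 'I_N) :
  (forall i j, (i, j) \in E -> i != j) ->
  nicely_connected PS E Phi ->
  nicely_weighted PS E lam mu Dm DM Delta beta B A alpha ->
  cycle_detection_trace PS E lam mu trace ->
  let bad := [set om | 0 <= cycle_weight (detected_cycle PS E s) om] `&`
             [set om | trace om = s] in
  measurable bad /\
  (P bad <= (expR (- (1 / 2 * ((alpha - beta) / (A + B)) ^+ 2
               * (Num.floor (Phi #|PS|))%:~R)))%:E *
            P [set om | trace om = s])%E.
Proof.
move=> Eirr connected weighted [trace_gt0 mtrace _ trace_indep] bad.
(* Only an attained list is known to be a possible execution; for any other one the event is
   empty. *)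
have [[om0 tr0]|notr] := pselect (exists om, trace om = s); last first.
  have tr0 : [set om | trace om = s] = set0.
    by apply/seteqP; split=> // om oms; apply: notr; exists om.
  by rewrite /bad tr0 setI0 measure0 mule0.
have := trace_gt0 om0; rewrite tr0 => /(detected_cycleP Eirr).
set c := detected_cycle _ _ _ in bad * => -[cyc uc _ [v vc]].
have cE := all_cycle_edges cyc.
have sE := sigma_of_cycle_weight cE.
split.
  apply: measurableI => //.
  apply: sigma_of_measurable sE => _ [[l _ <-]|[e _ <-]].
    exact: measurable_vweight.
  exact: measurable_eweight.
rewrite /bad trace_indep// lee_wpmul2r//.
apply: (le_trans (cycle_weight_tail weighted cE _)).
  by rewrite fst_cycle_edges.
rewrite lee_fin ler_expR lerN2 ler_wpM2l//.
  by apply: mulr_ge0; [rewrite divr_ge0|exact: sqr_ge0].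
rewrite /cycle_edges size_map [leRHS]pmulrn ler_int.
by apply: (le_trans (connected v)); rewrite lez_nat.
Qed.

End Detected_cycle_weight.

(** Admissibility is deterministic. The probability bound is expressed by a measurable event [S]
    contained in the set of outcomes where IOSS holds, so no measurability of that set is
    claimed. *)
Theorem proposition4
  (R : realType) (disp : measure_display) (T : measurableType disp)
  (P : probability T R)
  (N d m p : nat) (PS : {set 'I_N}) (E : {set 'I_N * 'I_N}) (Dm DM : nat)
  (f : T -> 'I_N -> 'rV[R]_d -> 'rV[R]_m -> 'rV[R]_d)
  (h : T -> 'I_N -> 'rV[R]_d -> 'rV[R]_p)
  (lam : 'I_N -> {RV P >-> R}) (mu : 'I_N -> 'I_N -> {RV P >-> R})
  (Phi : nat -> R) (Delta : nat) (beta B A alpha : R)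
  (trace : T -> seq 'I_N) (sigma : T -> nat -> 'I_N)
  (E_irrefl : forall i j, (i, j) \in E -> i != j)
  (standing : forall om : T,
     standing_assumptions PS E (f om) (h om)
       (fun i => lam i om) (fun i j => mu i j om))
  (Phi_incr : {homo Phi : k l / (k <= l)%N >-> k <= l})
  (connected : nicely_connected PS E Phi)
  (weighted : nicely_weighted PS E lam mu Dm DM Delta beta B A alpha)
  (trace_alg : cycle_detection_trace PS E lam mu trace)
  (sigma_constr : forall om : T,
     constructed_signal Delta (detected_cycle PS E (trace om)) (sigma om)) :
  (forall om : T, detected_cycle PS E (trace om) != [::] ->
     admissible E Dm DM (sigma om)) /\
  (exists S : set T,
    [/\ measurable S,
        S `<=` [set om | detected_cycle PS E (trace om) != [::] /\
                         IOSS (f om) (h om) (sigma om)] &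
        ((1 - expR (- (1 / 2 * ((alpha - beta) / (A + B)) ^+ 2
                       * (Num.floor (Phi #|PS|))%:~R)))%:E <= P S)%E]).
Proof.
have [trace_gt0 mtrace _ _] := trace_alg.
have cycleP om := detected_cycleP E_irrefl (trace_gt0 om).
have Delta0 om : detected_cycle PS E (trace om) != [::] -> (0 < Delta)%N.
  case: (detected_cycle _ _ _) => // v _ _.
  exact: dwell_time_gt0 v weighted.
split=> [om c0|].
  have [cyc uc _ _] := cycleP om; have [[DD _] _ _ _] := weighted.
  exact: constructed_signal_admissible (Delta0 om c0) DD (sigma_constr om).
pose weight := @cycle_weight _ T R N P PS lam mu Delta.
pose bad s := [set om | 0 <= weight (detected_cycle PS E s) om] `&`
              [set om | trace om = s].
have badP s := detected_cycle_tail s E_irrefl connected weighted trace_alg.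
(* A trace has no repetition, hence length at most [N]; finitely many lists cover all outcomes. *)
pose D : set (seq 'I_N) := range (fun t : N.-bseq 'I_N => t : seq 'I_N).
have finD : finite_set D by exact: finite_image.
have traceD om : D (trace om).
  have [v [s' [trE _ us _ _]]] := trace_prob_gt0 (trace_gt0 om).
  have sz : (size (trace om) <= N)%N.
    by rewrite -[X in (_ <= X)%N]card_ord -(card_uniqP us) max_card.
  by exists (Bseq sz).
have trivT (F : seq 'I_N -> set T) :
    (forall s, F s `<=` [set om | trace om = s]) -> trivIset D F.
  by move=> FT s s' _ _ [om [/FT <- /FT <-]].
pose bads := \bigcup_(s in D) bad s.
have mbads : measurable bads.
  by apply: fin_bigcup_measurable => // s _; have [] := badP s.
exists (~` bads); split; first exact: measurableC.
  move=> om nbad.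
  have wlt0 : weight (detected_cycle PS E (trace om)) om < 0.
    by rewrite ltNge; apply/negP => w0; apply: nbad; exists (trace om).
  (* The empty list has weight 0, so a negative weight also certifies that a cycle was found. *)
  have c0 : detected_cycle PS E (trace om) != [::].
    by apply: contraTneq wlt0 => ->; rewrite /weight cycle_weightE big_nil ltxx.
  split=> //; have [cyc uc cPS _] := cycleP om.
  apply: (IOSS_of_contractive_cycle (standing om) cyc uc cPS (Delta0 om c0)
    (sigma_constr om)).
  by rewrite -(cycle_weightE (PS := PS)).
rewrite probability_setC// EFinB leeB//.
rewrite /bads measure_fin_bigcup//; last 2 first.
- by apply: trivT => s om [].
- by move=> s _; have [] := badP s.
set eps := expR _.
(* Total probability: the events [trace om = s] partition the space, so the bounds add up to
   [eps]. *)
apply: (@le_trans _ _ (\sum_(s \in D) eps%:E * P [set om | trace om = s])%E).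
  by apply: lee_fsum => // s _; have [] := badP s.
rewrite -ge0_mule_fsumr//.
have <- : P (\bigcup_(s in D) [set om | trace om = s]) =
    (\sum_(s \in D) P [set om | trace om = s])%E.
  rewrite measure_fin_bigcup//; exact: trivT (fun s om => id).
have -> : \bigcup_(s in D) [set om | trace om = s] = [set: T].
  by apply/seteqP; split=> // om _; exists (trace om).
by rewrite probability_setT mule1.
Qed.
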